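(* For all integers $n\ge1$, $$\overline{spt1}(n)\equiv\left(\frac{n}{3}\right)\overline{\alpha}(n)\pmod 3,$$ where $\left(\frac{n}{3}\right)$ is the Legendre symbol.
   Context: An overpartition of $n$ is a partition of $n$ in which the first occurrence of each distinct part may be overlined. $\overline{spt1}(n)$ is the sum, over all overpartitions $\lambda$ of $n$ whose smallest part is odd, of the number of occurrences of the smallest part of $\lambda$. The (Dyson) rank of an overpartition is its largest part minus its number of parts, and $\overline{\alpha}(n)$ is the number of overpartitions of $n$ with even rank minus the number with odd rank. *)

(* Defs.v *)
From mathcomp Require Import all_boot all_order all_algebra.
Set Implicit Arguments. Unset Strict Implicit. Unset Printing Implicit Defensive.
Import Order.TTheory GRing.Theory Num.Theory.

(* An overpartition is represented canonically as a sequence of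
   (part, overlined?) pairs, listed in nonincreasing order of parts; within a
   run of equal parts only the first entry may be overlined (the "first
   occurrence" of that part). *)
Definition ovrel (x y : nat * bool) : bool :=
  (y.1 < x.1) || ((x.1 == y.1) && ~~ y.2).

Definition parts (s : seq (nat * bool)) : seq nat := map fst s.

Definition is_overpartition (n : nat) (s : seq (nat * bool)) : bool :=
  [&& all (fun x => 0 < x.1) s, sumn (parts s) == n & sorted ovrel s].

Fixpoint ov_cands (n k : nat) : seq (seq (nat * bool)) :=
  match k with
  | 0 => [:: [::]]
  | k'.+1 => [::] :: [seq x :: s | x <- [seq (i, b) | i <- iota 0 n.+1, b <- [:: true; false]],
                                   s <- ov_cands n k']
  end.

Definition overpartitions (n : nat) : seq (seq (nat * bool)) :=
  undup [seq s <- ov_cands n n | is_overpartition n s].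

Definition smallest_part (s : seq (nat * bool)) : nat :=
  foldr minn (head 0 (parts s)) (parts s).

Definition largest_part (s : seq (nat * bool)) : nat :=
  foldr maxn 0 (parts s).

Definition num_smallest (s : seq (nat * bool)) : nat :=
  count (fun p => p == smallest_part s) (parts s).

Definition spt1bar (n : nat) : nat :=
  \sum_(s <- overpartitions n | odd (smallest_part s)) num_smallest s.

Definition ov_rank (s : seq (nat * bool)) : int :=
  (largest_part s)%:Z - (size s)%:Z.

Definition alphabar (n : nat) : int :=
  (count (fun s => ~~ odd `|ov_rank s|%N) (overpartitions n))%:Z
  - (count (fun s => odd `|ov_rank s|%N) (overpartitions n))%:Z.

Definition legendre3 (n : nat) : int :=
  if n %% 3 == 0 then 0%Z else if n %% 3 == 1 then 1%Z else (-1)%Z.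

(* Main.v *)
(** Since (n/3) = n mod 3, the claim is that the generating function of spt1bar is
    congruent to theta A, where A = sum_n alphabar(n) q^n and theta = q d/dq.

    Put u_m = prod_(j <= m) (1 - q^j)/(1 + q^j), d_m = u_(m-1) - u_m, u = lim u_m and
    H(t) = 1 - sum_(m >= 1) d_m t^m.  Sorting overpartitions by largest part gives A = H(-1),
    and spt1bar has generating function Y_odd / u, where Y_odd and Y_even are the sums of
    d_m / (1 - q^m) over odd and even m.  Four facts combine:
    - u A = 1 - 4 Y_even, because (1 + tq) H(tq) = (2 - H(t)) (1 - tq) makes the products
      H(q^k) H(-q^k) telescope;
    - Y_odd - Y_even = 2 sum_m q^m / (1 + q^m)^2, a derivative of the q-Gauss sum;
    - theta u = - 2 u sum_m q^m / (1 + q^m)^2 modulo 3, by logarithmic differentiation;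
    - u theta Y_even - Y_even theta u + u Y_even = 0 modulo 3, that is theta S = - S for
      S = Y_even / u.
    For the last one, a finite form of Gauss's theta identity gives u = sum_a (-1)^a q^(a^2)
    and an Appell-Lerch expansion of Y_even; each coefficient then becomes a sum of cubic
    polynomials over solutions of a^2 + 2uv = N, which vanishes modulo 3 by reindexing along
    automorphisms of this ternary form.

    All sums and products are truncated, and identities hold up to a power of q. *)

Require Import Defs.
From HB Require Import structures.
From mathcomp Require Import all_boot all_order all_algebra.
From mathcomp Require Import boolp ring zify.
Import Order.TTheory GRing.Theory Num.Theory.
Set Implicit Arguments. Unset Strict Implicit. Unset Printing Implicit Defensive.

(** * Formal power series in q over a commutative ring *)

Section PowerSeries.
Local Open Scope ring_scope.

Definition fps (R : Type) := nat -> R.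

HB.instance Definition _ (R : Type) := gen_eqMixin (fps R).
HB.instance Definition _ (R : Type) := gen_choiceMixin (fps R).

Definition coefs (R : Type) (f : fps R) (n : nat) : R := f n.

Lemma fpsP (R : Type) (f g : fps R) : coefs f =1 coefs g -> f = g.
Proof. by move=> fg; apply/funext. Qed.

Variable R : comNzRingType.
Implicit Types f g h : fps R.

Definition fps_add f g : fps R := fun n => coefs f n + coefs g n.
Definition fps_opp f : fps R := fun n => - coefs f n.
Definition fps_zero : fps R := fun=> 0.
Definition fps_one : fps R := fun n => (n == 0)%:R.
Definition fps_mul f g : fps R :=
  fun n => \sum_(i < n.+1) coefs f i * coefs g (n - i).

Fact fps_addA : associative fps_add.
Proof. by move=> f g h; apply/fpsP=> n; apply: addrA. Qed.
Fact fps_addC : commutative fps_add.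
Proof. by move=> f g; apply/fpsP=> n; apply: addrC. Qed.
Fact fps_add0 : left_id fps_zero fps_add.
Proof. by move=> f; apply/fpsP=> n; apply: add0r. Qed.
Fact fps_addN : left_inverse fps_zero fps_opp fps_add.
Proof. by move=> f; apply/fpsP=> n; apply: addNr. Qed.

HB.instance Definition _ :=
  GRing.isZmodule.Build (fps R) fps_addA fps_addC fps_add0 fps_addN.

Let trunc n f : {poly R} := \poly_(i < n.+1) coefs f i.

Let coef_trunc n f i : (i <= n)%N -> (trunc n f)`_i = coefs f i.
Proof. by move=> le_in; rewrite coef_poly ltnS le_in. Qed.

(** Coefficient [m] of a product involves no coefficient beyond [m], so truncations compute it and
    the ring laws are inherited from [{poly R}]. *)
Let coefs_mul n m f g : (m <= n)%N -> coefs (fps_mul f g) m = (trunc n f * trunc n g)`_m.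
Proof.
move=> le_mn; rewrite coefM /coefs /fps_mul; apply: eq_bigr => i _.
by rewrite !coef_trunc //; case: i => i /=; lia.
Qed.

Fact fps_mulC : commutative fps_mul.
Proof. by move=> f g; apply/fpsP=> n; rewrite !(coefs_mul _ _ (leqnn n)) mulrC. Qed.

Fact fps_mulA : associative fps_mul.
Proof.
move=> f g h; apply/fpsP=> n; rewrite !(coefs_mul _ _ (leqnn n)).
have trM a b c : (trunc n a * trunc n (fps_mul b c))`_n = (trunc n a * (trunc n b * trunc n c))`_n.
  rewrite coefM [RHS]coefM; apply: eq_bigr => i _.
  by rewrite (coef_trunc _ (leq_subr i n)) (coefs_mul _ _ (leq_subr i n)).
by rewrite trM (mulrC (trunc n (fps_mul f g))) trM mulrA mulrC.
Qed.

Fact fps_mul1 : left_id fps_one fps_mul.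
Proof.
move=> f; apply/fpsP=> n; rewrite /coefs /fps_mul /fps_one big_ord_recl /= mul1r subn0.
by rewrite big1 ?addr0 // => i _; rewrite mul0r.
Qed.

Fact fps_mulD : left_distributive fps_mul fps_add.
Proof.
move=> f g h; apply/fpsP=> n; rewrite /coefs /fps_mul /fps_add -big_split /=.
by apply: eq_bigr => i _; rewrite mulrDl.
Qed.

Fact fps_one_neq0 : fps_one != 0.
Proof. by apply/eqP=> /(congr1 (fun f => coefs f 0)) /eqP; rewrite /coefs /= oner_eq0. Qed.

HB.instance Definition _ := GRing.Zmodule_isComNzRing.Build (fps R)
  fps_mulA fps_mulC fps_mul1 fps_mulD fps_one_neq0.

(** Invertibility is decided classically and an inverse is chosen; off the units the inverse is the
    identity, as the ring interface demands. *)
Definition fps_unit : {pred fps R} := fun f => `[< exists g, g * f = 1 >].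
Definition fps_inv f :=
  if pselect (exists g, g * f = 1) is left fu then projT1 (cid fu) else f.

Fact fps_mulVf : {in fps_unit, left_inverse 1 fps_inv *%R}.
Proof.
move=> f /asboolP fu; rewrite /fps_inv; case: pselect => // fu'.
by case: (cid fu').
Qed.
Fact fps_unitP f g : g * f = 1 -> f \in fps_unit.
Proof. by move=> gf; apply/asboolP; exists g. Qed.
Fact fps_inv_out : {in [predC fps_unit], fps_inv =1 id}.
Proof. by move=> f /asboolP fu; rewrite /fps_inv; case: pselect. Qed.

HB.instance Definition _ := GRing.ComNzRing_hasMulInverse.Build (fps R)
  fps_mulVf fps_unitP fps_inv_out.

Lemma coefs0 n : coefs (0 : fps R) n = 0. Proof. by []. Qed.
Lemma coefs1 n : coefs (1 : fps R) n = (n == 0)%:R. Proof. by []. Qed.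
Lemma coefsD f g n : coefs (f + g) n = coefs f n + coefs g n. Proof. by []. Qed.
Lemma coefsN f n : coefs (- f) n = - coefs f n. Proof. by []. Qed.
Lemma coefsB f g n : coefs (f - g) n = coefs f n - coefs g n. Proof. by []. Qed.
Lemma coefsM f g n : coefs (f * g) n = \sum_(i < n.+1) coefs f i * coefs g (n - i).
Proof. by []. Qed.
Lemma coefs_sum I (r : seq I) (P : pred I) (F : I -> fps R) n :
  coefs (\sum_(i <- r | P i) F i) n = \sum_(i <- r | P i) coefs (F i) n.
Proof. by elim/big_rec2: _ => // i x y _ <-. Qed.

Definition fpsX : fps R := fun n => (n == 1)%:R.

Lemma coefsXM f n : coefs (fpsX * f) n = if n is m.+1 then coefs f m else 0.
Proof.
rewrite coefsM; case: n => [|n]; first by rewrite big_ord1 mul0r.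
rewrite 2!big_ord_recl {1 2}/coefs /fpsX /= mul0r add0r mul1r subSS subn0.
by rewrite big1 ?addr0 // => i _; rewrite /coefs /= mul0r.
Qed.

Lemma coefsXnM k f n :
  coefs (fpsX ^+ k * f) n = if (k <= n)%N then coefs f (n - k) else 0.
Proof.
elim: k n => [|k IHk] n; first by rewrite mul1r subn0.
by rewrite exprS -mulrA coefsXM; case: n => // n; rewrite IHk.
Qed.

Lemma coefsXn k n : coefs (fpsX ^+ k) n = (n == k)%:R.
Proof.
rewrite -[fpsX ^+ k]mulr1 coefsXnM coefs1.
by case: leqP => [le_kn|lt_nk]; [congr (_%:R); lia | rewrite ltn_eqF].
Qed.

Definition theta f : fps R := fun n => n%:R * coefs f n.

Lemma coefs_theta f n : coefs (theta f) n = n%:R * coefs f n. Proof. by []. Qed.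

Lemma thetaD f g : theta (f + g) = theta f + theta g.
Proof. by apply/fpsP => n; rewrite !(coefsD, coefs_theta) mulrDr. Qed.
Lemma thetaN f : theta (- f) = - theta f.
Proof. by apply/fpsP => n; rewrite !(coefsN, coefs_theta) mulrN. Qed.
Lemma thetaB f g : theta (f - g) = theta f - theta g.
Proof. by rewrite thetaD thetaN. Qed.
Lemma theta1 : theta 1 = 0.
Proof. by apply/fpsP => n; rewrite coefs_theta coefs1; case: n => [|n]; rewrite (mul0r, mulr0). Qed.
Lemma theta0 : theta 0 = 0.
Proof. by apply/fpsP => n; rewrite coefs_theta mulr0. Qed.
Lemma theta_sum I (r : seq I) (P : pred I) (F : I -> fps R) :
  theta (\sum_(i <- r | P i) F i) = \sum_(i <- r | P i) theta (F i).
Proof. exact: (big_morph theta thetaD theta0). Qed.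
Lemma thetaM f g : theta (f * g) = theta f * g + f * theta g.
Proof.
apply/fpsP => n; rewrite coefsD coefs_theta !coefsM mulr_sumr -big_split /=.
apply: eq_bigr => i _; rewrite !coefs_theta.
rewrite -{1}(subnKC (ltn_ord i : (i <= n)%N)) natrD; ring.
Qed.
Lemma coefs_natl k f n : coefs (k%:R * f) n = k%:R * coefs f n.
Proof. by rewrite !mulr_natl; elim: k => [//|k IHk]; rewrite !mulrS coefsD IHk. Qed.
Lemma coefs_signl k f n : coefs ((-1) ^+ k * f) n = (-1) ^+ k * coefs f n.
Proof. by rewrite -signr_odd -[in RHS]signr_odd; case: odd; rewrite ?mulN1r ?mul1r. Qed.
Lemma thetaXn k : theta (fpsX ^+ k) = k%:R * fpsX ^+ k.
Proof.
by apply/fpsP => n; rewrite coefs_theta coefs_natl coefsXn; case: eqP => [->|_]; rewrite ?mulr0.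
Qed.

End PowerSeries.

(** * Divisibility by powers of q *)

Section PowerSeriesOrder.
Local Open Scope ring_scope.
Variable R : comNzRingType.
Implicit Types f g h : fps R.
Local Notation q := (fpsX R).

(* [ordge k f] says that q^k divides f. *)
Variant ordge k f : Prop := Ordge of forall n, (n < k)%N -> coefs f n = 0.

Lemma coefs_ordge n k f : ordge k f -> (n < k)%N -> coefs f n = 0.
Proof. by case=> fk; apply: fk. Qed.
Lemma ordge_le k l f : ordge l f -> (k <= l)%N -> ordge k f.
Proof. by case=> fl le_kl; constructor=> n lt_nk; apply: fl; apply: leq_trans le_kl. Qed.
Lemma ordge_0 k : ordge k 0.
Proof. by constructor. Qed.
Lemma ordgeD k f g : ordge k f -> ordge k g -> ordge k (f + g).
Proof. by case=> fk [gk]; constructor=> n lt_nk; rewrite coefsD fk ?gk ?addr0. Qed.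
Lemma ordgeN k f : ordge k f -> ordge k (- f).
Proof. by case=> fk; constructor=> n lt_nk; rewrite coefsN fk ?oppr0. Qed.
Lemma ordgeB k f g : ordge k f -> ordge k g -> ordge k (f - g).
Proof. by move=> fk gk; apply: ordgeD fk (ordgeN gk). Qed.
Lemma ordgeM k l f g : ordge k f -> ordge l g -> ordge (k + l) (f * g).
Proof.
case=> fk [gl]; constructor=> n lt_n; rewrite coefsM big1 // => i _.
case: (ltnP i k) => [/fk -> | le_ki]; first by rewrite mul0r.
by rewrite gl ?mulr0 //; move: (ltn_ord i) => *; lia.
Qed.
Lemma ordgeMr k f g : ordge k f -> ordge k (f * g).
Proof. by move=> fk; rewrite -[k]addn0; apply: ordgeM => //; constructor. Qed.
Lemma ordgeMl k f g : ordge k g -> ordge k (f * g).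
Proof. by rewrite mulrC; apply: ordgeMr. Qed.
Lemma ordgeXn k f l : ordge k f -> ordge (l * k) (f ^+ l).
Proof. by move=> fk; elim: l => // l IHl; rewrite exprS mulSn; apply: ordgeM. Qed.
Lemma ordge_sum k I (r : seq I) (P : pred I) (F : I -> fps R) :
  (forall i, P i -> ordge k (F i)) -> ordge k (\sum_(i <- r | P i) F i).
Proof. by move=> Fk; elim/big_ind: _ => //; [exact: ordgeD]. Qed.
Lemma ordge_q k : ordge k (q ^+ k).
Proof. by constructor=> n lt_nk; rewrite coefsXn ltn_eqF. Qed.
Lemma ordge_qle k l : (k <= l)%N -> ordge k (q ^+ l).
Proof. exact: ordge_le (ordge_q l). Qed.
Lemma ordge_theta k f : ordge k f -> ordge k (theta f).
Proof. by case=> fk; constructor=> n lt_nk; rewrite coefs_theta fk ?mulr0. Qed.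

(** Geometric series: q^k divides [f ^+ k], so coefficient [n] of the partial sums is constant from
    [S n] on, and the diagonal of these sums is the inverse. *)
Lemma unit_1B f : ordge 1 f -> 1 - f \is a GRing.unit.
Proof.
move=> f1; apply/unitrPr.
pose S N := \sum_(k < N.+1) f ^+ k.
have coefsS n N : (n <= N)%N -> coefs (S N) n = coefs (S n) n.
  move=> le_nN; rewrite -(subnKC le_nN); elim: (N - n)%N => [|m IHm]; first by rewrite addn0.
  rewrite addnS {1}/S big_ord_recr coefsD -/(S _) IHm /= (_ : coefs (f ^+ _) n = 0) ?addr0 //.
  by apply: (coefs_ordge (ordgeXn (n + m).+1 f1)); rewrite muln1 ltnS leq_addr.
exists (fun n => coefs (S n) n); apply/fpsP => n.
transitivity (coefs ((1 - f) * S n) n).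
  rewrite !coefsM; apply: eq_bigr => i _; congr (_ * _).
  by rewrite {1}/coefs coefsS ?leq_subr.
rewrite -opprB mulNr -subrX1 opprB coefsB (_ : coefs (f ^+ _) n = 0) ?subr0 //.
by apply: (coefs_ordge (ordgeXn n.+1 f1)); rewrite muln1.
Qed.

Lemma unit_1D f : ordge 1 f -> 1 + f \is a GRing.unit.
Proof. by move=> f1; rewrite -[f]opprK; apply/unit_1B/ordgeN. Qed.

Lemma ordge1_q k : (0 < k)%N -> ordge 1 (q ^+ k).
Proof. by move=> k_gt0; apply: (ordge_le (ordge_q k)). Qed.

Lemma unit_qB k : (0 < k)%N -> 1 - q ^+ k \is a GRing.unit.
Proof. by move=> k_gt0; apply/unit_1B/ordge1_q. Qed.
Lemma unit_qD k : (0 < k)%N -> 1 + q ^+ k \is a GRing.unit.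
Proof. by move=> k_gt0; apply/unit_1D/ordge1_q. Qed.

Lemma divr_eqP (x y z : fps R) : y \is a GRing.unit -> x = z * y -> x / y = z.
Proof. by move=> yu ->; rewrite mulrK. Qed.

Lemma ordge_mulI k f g : g \is a GRing.unit -> ordge k (f * g) -> ordge k f.
Proof. by move=> gu fg; rewrite -[f](mulrK gu); apply: ordgeMr. Qed.

End PowerSeriesOrder.

(** * Telescoping of H(q^k) H(-q^k) *)

Section USeq.
Local Open Scope ring_scope.
Variable R : comNzRingType.
Local Notation q := (fpsX R).
Implicit Types x t : fps R.

Definition qpoch n : fps R := \prod_(j < n) (1 - q ^+ j.+1).
Definition useq n : fps R := qpoch n / \prod_(j < n) (1 + q ^+ j.+1).
(* [dseq n] is d_(n+1) of the header. *)
Definition dseq n : fps R := useq n - useq n.+1.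

Lemma unit_prod n (F : nat -> fps R) :
  (forall j, (j < n)%N -> F j \is a GRing.unit) -> \prod_(j < n) F j \is a GRing.unit.
Proof. by move=> Fu; elim/big_ind: _ => [|x y xu yu|[j ltj] _]; rewrite ?unitr1 ?unitrM ?xu //; apply: Fu. Qed.

Lemma useq0 : useq 0 = 1.
Proof. by rewrite /useq /qpoch !big_ord0 divr1. Qed.

Lemma qpochS n : qpoch n.+1 = qpoch n * (1 - q ^+ n.+1).
Proof. by rewrite /qpoch big_ord_recr. Qed.

Lemma useqS n : useq n.+1 * (1 + q ^+ n.+1) = useq n * (1 - q ^+ n.+1).
Proof.
have Du : \prod_(j < n) (1 + q ^+ j.+1) \is a GRing.unit.
  by apply: (unit_prod (F := fun j => 1 + q ^+ j.+1)) => j _; rewrite unit_qD.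
rewrite /useq qpochS big_ord_recr /= invrM ?unit_qD //.
by rewrite -!mulrA [_^-1 * (1 + _)]mulrC mulKr ?unit_qD // [_^-1 * _]mulrC.
Qed.

Lemma useq_unit n : useq n \is a GRing.unit.
Proof.
rewrite unitrM unitrV (unit_prod (F := fun j => 1 - q ^+ j.+1)) => [|j _]; last exact: unit_qB.
by rewrite (unit_prod (F := fun j => 1 + q ^+ j.+1)) => // j _; apply: unit_qD.
Qed.

Lemma dseqD n : dseq n * (1 + q ^+ n.+1) = 2%:R * q ^+ n.+1 * useq n.
Proof. by rewrite mulrBl useqS; ring. Qed.

Lemma dseqB n : dseq n * (1 - q ^+ n.+1) = 2%:R * q ^+ n.+1 * useq n.+1.
Proof. by rewrite mulrBl -useqS; ring. Qed.

Definition Hsum M t : fps R := 1 - \sum_(m < M) t ^+ m.+1 * dseq m.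

(** Truncated form of (1 + tq) H(tq) = (2 - H(t)) (1 - tq). In the induction each new term is
    absorbed by the two expressions [dseqB] and [dseqD] for d_m; the last summand is the truncation
    error. *)
Lemma Hsum_shift M t :
  Hsum M (t * q) * (1 + t * q) =
  (2%:R - Hsum M t) * (1 - t * q) + 2%:R * (t * q) ^+ M.+1 * useq M.
Proof.
elim: M => [|M IHM]; first by rewrite /Hsum !big_ord0 useq0; ring.
have HS s : Hsum M.+1 s = Hsum M s - s ^+ M.+1 * dseq M.
  by rewrite /Hsum big_ord_recr /= opprD addrA.
rewrite !HS mulrBl IHM [(_ * q) ^+ M.+2]exprS exprMn.
move: (dseqB M) (dseqD M).
move: (t ^+ _) (q ^+ _) (dseq M) (useq M) (useq M.+1) (Hsum M t) => y Z d u v H dB dD.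
have -> : 2%:R * (t * q * (y * Z)) * v = y * t * q * (2%:R * Z * v) by ring.
have -> : 2%:R * (y * Z) * u = y * (2%:R * Z * u) by ring.
by rewrite -dB -dD; ring.
Qed.

Lemma Hsum1 M : Hsum M 1 = useq M.
Proof.
elim: M => [|M IHM]; first by rewrite /Hsum big_ord0 useq0 subr0.
have -> : Hsum M.+1 1 = Hsum M 1 - dseq M.
  by rewrite /Hsum big_ord_recr /= expr1n mul1r opprD addrA.
by rewrite IHM /dseq; ring.
Qed.

Definition Ysum (P : pred nat) M : fps R :=
  \sum_(m < M | P m.+1) dseq m / (1 - q ^+ m.+1).

(* The products H(q^k) H(-q^k) telescope: the recursion sends (a, h) to (2 - a, 2 - h) up to
   mutually inverse factors. *)
Lemma useq_Hsum M :
  ordge M.+1 (useq M * Hsum M (-1) - (1 - 4%:R * Ysum (predC odd) M)).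
Proof.
pose h k := Hsum M (q ^+ k); pose a k := Hsum M (- q ^+ k).
(* The equations at t = q^k and t = -q^k are multiplied; the units 1 + q^(k+1) and 1 - q^(k+1) then
   occur on both sides and cancel. *)
have step k : ordge M.+1 (h k.+1 * a k.+1 - (2%:R - h k) * (2%:R - a k)).
  have unitE : (1 + q ^+ k.+1) * (1 - q ^+ k.+1) \is a GRing.unit.
    by rewrite unitrM unit_qD ?unit_qB.
  apply: (ordge_mulI unitE); have := Hsum_shift M (q ^+ k); have := Hsum_shift M (- q ^+ k).
  rewrite !mulNr -exprSr -/(h k) -/(h k.+1) -/(a k) -/(a k.+1).
  set Z := q ^+ k.+1.
  have Zo : ordge M.+1 (Z ^+ M.+1) by rewrite /Z -exprM; apply: ordge_qle; rewrite leq_pmull.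
  have nZo : ordge M.+1 ((- Z) ^+ M.+1) by rewrite exprNn; apply: ordgeMl.
  move=> aS hS.
  set Ea := 2%:R * (- Z) ^+ _ * _ in aS; set Eh := 2%:R * Z ^+ _ * _ in hS.
  have Eao : ordge M.+1 Ea by rewrite /Ea; apply/ordgeMr/ordgeMl.
  have Eho : ordge M.+1 Eh by rewrite /Eh; apply/ordgeMr/ordgeMl.
  have -> : (h k.+1 * a k.+1 - (2%:R - h k) * (2%:R - a k)) * ((1 + Z) * (1 - Z)) =
     (h k.+1 * (1 + Z)) * (a k.+1 * (1 - Z)) - (2%:R - h k) * (2%:R - a k) * (1 + Z) * (1 - Z) by ring.
  rewrite hS aS.
  have -> : ((2%:R - h k) * (1 - Z) + Eh) * ((2%:R - a k) * (1 - - Z) + Ea) -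
      (2%:R - h k) * (2%:R - a k) * (1 + Z) * (1 - Z) =
      Ea * ((2%:R - h k) * (1 - Z)) + Eh * ((2%:R - a k) * (1 - - Z) + Ea) by ring.
  by apply: ordgeD; apply: ordgeMr.
(* Since (2 - h)(2 - a) = h a + 4 - 2 (h + a), each step adds 4 - 2 (h + a). *)
have tele K : ordge M.+1 (h K * a K - h 0 * a 0 - \sum_(k < K) (4%:R - 2%:R * (h k + a k))).
  elim: K => [|K IHK]; first by rewrite big_ord0 subrr subr0.
  rewrite big_ord_recr /=.
  have -> : h K.+1 * a K.+1 - h 0 * a 0 - (\sum_(k < K) (4%:R - 2%:R * (h k + a k)) +
       (4%:R - 2%:R * (h K + a K))) =
     (h K.+1 * a K.+1 - (2%:R - h K) * (2%:R - a K)) +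
      (h K * a K - h 0 * a 0 - \sum_(k < K) (4%:R - 2%:R * (h k + a k))) by ring.
  exact: ordgeD.
(* At [k = M.+1] both factors are 1 up to the error, which closes the telescope; at [k = 0] they are
   u and A. *)
have Hq s : ordge M.+1 (Hsum M (s * q ^+ M.+1) - 1).
  rewrite /Hsum addrAC subrr add0r; apply/ordgeN/ordge_sum => m _.
  by apply: ordgeMr; rewrite exprMn -exprM; apply: ordgeMl; apply: ordge_qle; lia.
(* The terms of odd index cancel in [h k + a k]; for each even index the sum over [k] is
   geometric. *)
have sumE K : \sum_(k < K) (4%:R - 2%:R * (h k + a k)) =
   4%:R * \sum_(m < M | ~~ odd m.+1) dseq m * (1 - (q ^+ m.+1) ^+ K) / (1 - q ^+ m.+1).
  transitivity (\sum_(k < K) 4%:R * \sum_(m < M | ~~ odd m.+1) dseq m * (q ^+ m.+1) ^+ k).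
    apply: eq_bigr => k _; rewrite /h /a /Hsum.
    have -> A B : 4%:R - 2%:R * (1 - A + (1 - B)) = 2%:R * (A + B) :> fps R by ring.
    rewrite -big_split /= [in RHS]big_mkcond /= !mulr_sumr; apply: eq_bigr => m _.
    rewrite (exprNn (q ^+ k)) -signr_odd /= -!exprM mulnC.
    by case: odd => /=; ring.
  rewrite -mulr_sumr exchange_big /=; congr (_ * _); apply: eq_bigr => m _.
  rewrite -mulr_sumr -mulrA; congr (_ * _).
  by apply/esym/divr_eqP; rewrite ?unit_qB // -opprB subrX1 -mulNr opprB mulrC.
have := tele M.+1.
have := sumE M.+1 => ->; rewrite {2}/h {2}/a expr0 Hsum1.
have hM : ordge M.+1 (h M.+1 - 1) by have := Hq 1; rewrite mul1r.
have aM : ordge M.+1 (a M.+1 - 1) by have := Hq (-1); rewrite mulN1r.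
move=> T; pose E := \sum_(m < M | ~~ odd m.+1) dseq m * (q ^+ m.+1) ^+ M.+1 / (1 - q ^+ m.+1).
have Eo : ordge M.+1 E.
  by apply: ordge_sum => m _; apply/ordgeMr/ordgeMl; rewrite -exprM; apply: ordge_qle; lia.
have YE : \sum_(m < M | ~~ odd m.+1) dseq m * (1 - (q ^+ m.+1) ^+ M.+1) / (1 - q ^+ m.+1)
    = Ysum (predC odd) M - E.
  by rewrite /Ysum /E -sumrB; apply: eq_bigr => m _; ring.
rewrite YE in T.
have -> : useq M * Hsum M (-1) - (1 - 4%:R * Ysum (predC odd) M) =
  4%:R * E + (h M.+1 - 1) * a M.+1 + (a M.+1 - 1)
   - (h M.+1 * a M.+1 - useq M * Hsum M (-1) - 4%:R * (Ysum (predC odd) M - E)) by ring.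
by apply: ordgeB T; apply: ordgeD => //; apply: ordgeD; [apply: ordgeMl | apply: ordgeMr].
Qed.

End USeq.

Lemma invr_eqP (R : comUnitRingType) (x y : R) : x \is a GRing.unit -> (y * x = 1)%R -> (x^-1 = y)%R.
Proof. by move=> xu yx; apply: (mulIr xu); rewrite mulVr. Qed.

Lemma eq_divM (R : comUnitRingType) (a b c d x y : R) :
  x \is a GRing.unit -> y \is a GRing.unit ->
  (a * c * y = b * d * x)%R -> (a / x * c = b / y * d)%R.
Proof.
move=> xu yu E; apply: (mulIr xu); apply: (mulIr yu).
transitivity (a * c * y * (x / x))%R; first by ring.
by rewrite E divrr // mulr1 [RHS]mulrAC -mulrA [(b / y * d)%R]mulrAC divrK // mulrA.
Qed.

(** * The difference of the odd and even parts *)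

Section Gauss.
Local Open Scope ring_scope.
Variable R : comNzRingType.
Local Notation q := (fpsX R).
Implicit Types x t : fps R.

Let den x n : fps R := \prod_(i < n) (1 + x * q ^+ i).

Let den_unit x n : ordge 1 x -> den x n \is a GRing.unit.
Proof.
move=> x1; apply: (unit_prod (F := fun i => 1 + x * q ^+ i)) => i _.
exact/unit_1D/ordgeMr.
Qed.

Let term x n : fps R := (- x) ^+ n.+1 * qpoch R n / den x n.+1.
Let total x M : fps R := \sum_(n < M) term x n / (1 - q ^+ n.+1).

(* This is the second derivative at z = 1 of the q-Gauss sum with parameters z, 1/z; the step
   from x to xq telescopes in n. *)
Let total_shift x M : ordge 1 x ->
  total x M - total (x * q) M = - x / (1 + x) ^+ 2 + x / (1 + x) * ((- x) ^+ M * (qpoch R M / den x M.+1)).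
Proof.
move=> x1; have xu : 1 + x \is a GRing.unit by apply: unit_1D.
have xq n : ordge 1 (x * q ^+ n) by apply: ordgeMr.
have xqu n : 1 + x * q ^+ n \is a GRing.unit by apply: unit_1D.
(* [y] is the telescoping certificate: the difference of the [n]-th terms at x and xq is
   [y n - y n.+1] times a factor independent of [n]. *)
pose y n := (- x) ^+ n * (qpoch R n / den x n.+1).
have denS n : den x n.+1 = den x n * (1 + x * q ^+ n) by rewrite /den big_ord_recr.
have denSl n : den x n.+1 = (1 + x) * den (x * q) n.
  rewrite /den big_ord_recl mulr1; congr (_ * _); apply: eq_bigr => i _.
  by rewrite /= /bump /= exprS mulrA.
have step n : term x n / (1 - q ^+ n.+1) - term (x * q) n / (1 - q ^+ n.+1) = - x / (1 + x) * (y n - y n.+1).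
  have d1 : den x n.+2 \is a GRing.unit by apply: den_unit.
  have d2 : den x n.+1 \is a GRing.unit by apply: den_unit.
  have d3 : den (x * q) n.+1 \is a GRing.unit by apply: den_unit; apply: ordgeMr.
  have qu : 1 - q ^+ n.+1 \is a GRing.unit by apply: unit_qB.
  have E1 : (den x n.+1)^-1 = (1 + x * q ^+ n.+1) / den x n.+2.
    by apply: invr_eqP => //; rewrite mulrAC [_ * den x n.+1]mulrC -denS divrr.
  have E2 : (den (x * q) n.+1)^-1 = (1 + x) / den x n.+2.
    by apply: invr_eqP => //; rewrite mulrAC -denSl divrr.
  apply: (mulIr qu); rewrite mulrBl !divrK //.
  apply: (mulIr xu).
  have -> (a b c : fps R) : a / (1 + x) * b * c * (1 + x) = a * b * c * ((1 + x) / (1 + x)) by ring.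
  rewrite divrr // mulr1.
  have xqn : (- (x * q)) ^+ n = (- x) ^+ n * q ^+ n by rewrite -mulNr exprMn.
  by rewrite /term /y E1 E2 qpochS !exprS xqn; ring.
rewrite /total -sumrB; under eq_bigr do rewrite step; rewrite -mulr_sumr.
have -> : \sum_(n < M) (y n - y n.+1) = y 0 - y M.
  elim: M => [|M IHM]; first by rewrite big_ord0 subrr.
  by rewrite big_ord_recr /= IHM; ring.
have -> : y 0 = (1 + x)^-1 by rewrite /y /qpoch big_ord0 /den big_ord1 !mulr1 !mul1r.
by rewrite expr2 invrM // /y; ring.
Qed.

(** The first sum is Y_even - Y_odd and equals twice [total] at x = q. Passing from x = q^j to
    q^(j+1) releases -q^j / (1 + q^j)^2, and at x = q^(M+1) the total is negligible. *)
Lemma Ysum_signed M :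
  ordge M.+1 (\sum_(m < M) (-1) ^+ m.+1 * dseq R m / (1 - q ^+ m.+1) +
              2%:R * \sum_(j < M) q ^+ j.+1 / (1 + q ^+ j.+1) ^+ 2).
Proof.
have q1 j : ordge 1 (q ^+ j.+1) by apply: ordge1_q.
have -> : \sum_(m < M) (-1) ^+ m.+1 * dseq R m / (1 - q ^+ m.+1) = 2%:R * total (q ^+ 1) M.
  rewrite /total mulr_sumr; apply: eq_bigr => m _; rewrite mulrA; congr (_ / _).
  have du : 1 + q ^+ m.+1 \is a GRing.unit by apply: unit_qD.
  have dE k : den (q ^+ 1) k = \prod_(j < k) (1 + q ^+ j.+1).
    by apply: eq_bigr => j _; rewrite -exprD.
  apply: (mulIr du); rewrite -mulrA dseqD /term /useq dE big_ord_recr /= -dE.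
  rewrite invrM ?den_unit ?q1 // (exprNn (q ^+ 1)) -exprM mul1n.
  have -> : 2%:R * ((-1) ^+ m.+1 * q ^+ m.+1 * qpoch R m * ((1 + q ^+ m.+1)^-1 / den (q ^+ 1) m)) * (1 + q ^+ m.+1)
    = 2%:R * ((-1) ^+ m.+1 * q ^+ m.+1 * qpoch R m / den (q ^+ 1) m) * ((1 + q ^+ m.+1) / (1 + q ^+ m.+1)) by ring.
  by rewrite divrr // mulr1; ring.
have tele K : ordge M.+1 (total (q ^+ 1) M - total (q ^+ K.+1) M +
    \sum_(j < K) q ^+ j.+1 / (1 + q ^+ j.+1) ^+ 2).
  elim: K => [|K IHK]; first by rewrite big_ord0 subrr addr0.
  have := total_shift M (q1 K); rewrite -exprSr big_ord_recr /= => tS.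
  set S := \sum_(j < K) _ in IHK *.
  have -> : total (q ^+ 1) M - total (q ^+ K.+2) M + (S + q ^+ K.+1 / (1 + q ^+ K.+1) ^+ 2) =
     (total (q ^+ 1) M - total (q ^+ K.+1) M + S) +
     (total (q ^+ K.+1) M - total (q ^+ K.+2) M + q ^+ K.+1 / (1 + q ^+ K.+1) ^+ 2) by ring.
  apply: ordgeD => //; rewrite tS.
  have -> (a b c d : fps R) : - a / b + a / d * c + a / b = c * a / d by ring.
  apply: ordgeMr; rewrite mulrAC -[M.+1]addn1; apply/ordgeMr/ordgeM => //.
  by rewrite exprNn -exprM; apply/ordgeMl/ordge_qle; rewrite mulSn leq_addr.
have last : ordge M.+1 (total (q ^+ M.+1) M).
  apply: ordge_sum => n _; apply/ordgeMr/ordgeMr/ordgeMr; rewrite exprNn -exprM.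
  by apply/ordgeMl/ordge_qle; lia.
rewrite -mulrDr; apply: ordgeMl.
by have := ordgeD (tele M) last; rewrite addrAC subrK.
Qed.

End Gauss.

(** * The even part as an Appell-Lerch sum *)

Section Bailey.
Local Open Scope ring_scope.
Variable R : comNzRingType.
Local Notation q := (fpsX R).
Local Notation Q := (q ^+ 2).

(* [bailey n r] is (Q;Q)_n^2 / ((Q;Q)_{n-r} (Q;Q)_{n+r}); it vanishes for r > n. *)
Definition bailey n r : fps R :=
  \prod_(j < r) ((1 - Q ^+ (n - j)) / (1 - Q ^+ (n + j.+1))).

Let unitQ k : (0 < k)%N -> 1 - Q ^+ k \is a GRing.unit.
Proof. by move=> k0; rewrite -exprM unit_qB ?muln_gt0. Qed.

Lemma bailey0 n : bailey n 0 = 1.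
Proof. exact: big_ord0. Qed.

Lemma baileyS n r : bailey n r.+1 * (1 - Q ^+ (n + r.+1)) = bailey n r * (1 - Q ^+ (n - r)).
Proof. by rewrite /bailey big_ord_recr /= -mulrA divrK // unitQ // addnS. Qed.

Lemma bailey_gt n r : (n < r)%N -> bailey n r = 0.
Proof.
elim: r => // r IHr; rewrite ltnS leq_eqVlt => /predU1P[->|/IHr bn];
  rewrite /bailey big_ord_recr /= -/(bailey _ _).
  by rewrite subnn expr0 subrr mul0r mulr0.
by rewrite bn mul0r.
Qed.

(** This is the ratio of the closed forms at [n] and [n.+1]. For [r > n] both sides vanish, the
    right one because [n.+1 - r] is truncated to 0. *)
Lemma bailey_shift n r :
  bailey n r * (1 - Q ^+ n.+1) ^+ 2 =
  bailey n.+1 r * (1 - Q ^+ (n.+1 - r)) * (1 - Q ^+ (n.+1 + r)).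
Proof.
elim: r => [|r IHr]; first by rewrite !bailey0 subn0 addn0; ring.
have u1 : 1 - Q ^+ (n + r.+1) \is a GRing.unit by rewrite unitQ // addnS.
have := baileyS n.+1 r; rewrite subSS => E.
rewrite [RHS]mulrAC E; apply: (mulIr u1).
rewrite [LHS]mulrAC baileyS [LHS]mulrAC IHr addSn -addnS.
by rewrite -[LHS]mulrA [X in _ * X = _]mulrC mulrA.
Qed.

(* Telescoping in r, in the manner of Wilf and Zeilberger, shows that this sum is u_(2n). *)
Definition gauss_sum n k : fps R :=
  1 + 2%:R * \sum_(r < k) (-1) ^+ r.+1 * q ^+ (r.+1 ^ 2) * bailey n r.+1.

(** Partial sums of the recurrence that takes u_(2n) to u_(2n+2). The right side is the certificate;
    it vanishes at [k = n.+1]. *)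
Let gauss_sum_step n k : (k <= n.+1)%N ->
  (1 - q ^+ (2 * n.+1)) * ((1 + q ^+ (2 * n).+1) * (1 + q ^+ (2 * n.+1)) * gauss_sum n.+1 k -
    (1 - q ^+ (2 * n).+1) * (1 - q ^+ (2 * n.+1)) * gauss_sum n k) =
  2%:R * (-1) ^+ k * q ^+ (k ^ 2 + (2 * n).+1) * bailey n.+1 k *
    (1 - Q ^+ (n.+1 - k)) * (1 + q ^+ (2 * k).+1).
Proof.
elim: k => [|k IHk] le_kn.
  rewrite /gauss_sum !big_ord0 bailey0 subn0 -exprM.
  have -> : q ^+ (2 * n.+1) = q ^+ (2 * n).+1 * q by rewrite -exprSr; congr (_ ^+ _); lia.
  rewrite exp0n // add0n muln0; ring.
have GS m : gauss_sum m k.+1 = gauss_sum m k +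
    2%:R * (-1) ^+ k.+1 * q ^+ (k.+1 ^ 2) * bailey m k.+1.
  by rewrite /gauss_sum big_ord_recr /= mulrDr addrA !mulrA.
have E1 := bailey_shift n k.+1; have E2 := baileyS n.+1 k.
move: (IHk (ltnW le_kn)); rewrite !GS.
(* Every power of q becomes a monomial in [B], [b], [c] and q, so that the induction step is a
   polynomial identity modulo [E1] and [E2]. *)
set B := q ^+ (2 * (n.+1 - k.+1)); set b := q ^+ (2 * k).+1; set c := q ^+ (k ^ 2).
have V : q ^+ (2 * n).+1 = B * b by rewrite -exprD; congr (_ ^+ _); lia.
have W : q ^+ (2 * n.+1) = B * b * q by rewrite -exprD -exprSr; congr (_ ^+ _); lia.
have C : q ^+ (k.+1 ^ 2) = c * b by rewrite -exprD; congr (_ ^+ _); rewrite -addn1 sqrnD; lia.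
have QB : Q ^+ (n.+1 - k.+1) = B by rewrite -exprM.
have QB' : Q ^+ (n.+1 - k) = B * q ^+ 2 by rewrite -exprM -exprD; congr (_ ^+ _); lia.
have QW : Q ^+ n.+1 = B * b * q by rewrite -W -exprM.
have QS : Q ^+ (n.+1 + k.+1) = B * b * q * (q * b).
  by rewrite -W -exprS -exprD -exprM; congr (_ ^+ _); lia.
have b2 : q ^+ (2 * k.+1).+1 = b * q ^+ 2 by rewrite -exprD; congr (_ ^+ _); lia.
have sgn : (-1) ^+ k.+1 = - (-1) ^+ k :> fps R by rewrite exprS mulN1r.
move: E1 E2; rewrite QB QB' QW QS !exprD V W C b2 sgn -/c.
move: (bailey n.+1 k.+1) (bailey n k.+1) (bailey n.+1 k) (gauss_sum n.+1 k) (gauss_sum n k) ((-1) ^+ k).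
move=> P' p P0 G' G s E1 E2 IH.
transitivity (2%:R * s * (c * (B * b)) * P0 * (1 - B * Q) * (1 + b) -
    2%:R * s * (c * b) * ((1 - B * b * q) * (1 + B * b * q) * (1 + B * b) * P' -
                      (1 - B * b) * (p * (1 - B * b * q) ^+ 2))).
  by rewrite -IH; ring.
by rewrite -[_ * P0 * _]mulrA -E2 E1; ring.
Qed.

(** At [k = n.+1] the certificate and the top term of [gauss_sum n n.+1] are zero, so both sides
    obey the recurrence given by two uses of [useqS]. *)
Lemma gauss_sumE n : gauss_sum n n = useq R (2 * n).
Proof.
elim: n => [|n IHn]; first by rewrite /gauss_sum big_ord0 mulr0 addr0 muln0 useq0.
have u1 : 1 - q ^+ (2 * n.+1) \is a GRing.unit by rewrite unit_qB.
have u2 : 1 + q ^+ (2 * n).+1 \is a GRing.unit by rewrite unit_qD.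
have u3 : 1 + q ^+ (2 * n.+1) \is a GRing.unit by rewrite unit_qD ?muln_gt0.
have := gauss_sum_step (leqnn n.+1); rewrite subnn expr0 subrr mulr0 mul0r.
have -> : gauss_sum n n.+1 = gauss_sum n n.
  by rewrite /gauss_sum big_ord_recr /= bailey_gt // mulr0 addr0.
move/(canRL (mulKr u1)); rewrite mulr0 IHn => /eqP; rewrite subr_eq0 => /eqP E.
apply: (mulrI u2); apply: (mulrI u3).
have := useqS R (2 * n); have := useqS R (2 * n).+1.
have -> : (2 * n.+1 = (2 * n).+2)%N by lia.
move: E; have -> : (2 * n.+1 = (2 * n).+2)%N by lia.
move: (gauss_sum _ _) (useq R (2 * n)) (useq R (2 * n).+1) (useq R (2 * n).+2) => g u0 u1' u2' E S2 S1.
transitivity ((1 - q ^+ (2 * n).+1) * (1 - q ^+ (2 * n).+2) * u0); first by rewrite -E; ring.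
transitivity (u2' * (1 + q ^+ (2 * n).+2) * (1 + q ^+ (2 * n).+1)); last by ring.
rewrite S2; transitivity (u1' * (1 + q ^+ (2 * n).+1) * (1 - q ^+ (2 * n).+2)); last by ring.
by rewrite S1; ring.
Qed.

(** Turns a weighted value at [n.+1] into an increment in [n], so that sums over [n] telescope for
    fixed [r]. *)
Let bailey_diff n r : (0 < r <= n.+1)%N ->
  Q ^+ n.+1 / (1 - Q ^+ n.+1) ^+ 2 * bailey n.+1 r =
  Q ^+ r / (1 - Q ^+ r) ^+ 2 * (bailey n.+1 r - bailey n r).
Proof.
case/andP=> r_gt0 le_rn; apply: eq_divM; rewrite ?unitrX ?unitQ //.
have E := bailey_shift n r.
have QW : Q ^+ n.+1 = Q ^+ (n.+1 - r) * Q ^+ r by rewrite -exprD subnK.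
have QS : Q ^+ (n.+1 + r) = Q ^+ (n.+1 - r) * Q ^+ r * Q ^+ r by rewrite -QW -exprD.
rewrite [in RHS]mulrBr [in RHS]mulrBl -[in X in _ = _ - X]mulrA E QS QW; ring.
Qed.

(** After interchanging the sums, the sum over [i] telescopes by [bailey_diff] and leaves its
    endpoint [bailey n r.+1]. *)
Lemma sum_bailey n :
  \sum_(i < n) Q ^+ i.+1 / (1 - Q ^+ i.+1) ^+ 2 * gauss_sum i.+1 i.+1 =
  \sum_(i < n) Q ^+ i.+1 / (1 - Q ^+ i.+1) ^+ 2 +
  2%:R * \sum_(r < n) (-1) ^+ r.+1 * q ^+ (r.+1 ^ 2) *
     (Q ^+ r.+1 / (1 - Q ^+ r.+1) ^+ 2 * bailey n r.+1).
Proof.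
elim: n => [|n IHn]; first by rewrite !big_ord0 mulr0 addr0.
pose t r : fps R := (-1) ^+ r.+1 * q ^+ (r.+1 ^ 2).
have key : \sum_(r < n.+1) t r * (Q ^+ r.+1 / (1 - Q ^+ r.+1) ^+ 2 * bailey n.+1 r.+1) =
   \sum_(r < n) t r * (Q ^+ r.+1 / (1 - Q ^+ r.+1) ^+ 2 * bailey n r.+1) +
   Q ^+ n.+1 / (1 - Q ^+ n.+1) ^+ 2 * \sum_(r < n.+1) t r * bailey n.+1 r.+1.
  have -> : \sum_(r < n) t r * (Q ^+ r.+1 / (1 - Q ^+ r.+1) ^+ 2 * bailey n r.+1) =
            \sum_(r < n.+1) t r * (Q ^+ r.+1 / (1 - Q ^+ r.+1) ^+ 2 * bailey n r.+1).
    by rewrite big_ord_recr /= bailey_gt // !mulr0 addr0.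
  rewrite mulr_sumr -big_split; apply: eq_bigr => r _ /=.
  by rewrite [X in _ = _ + X]mulrCA bailey_diff ?ltn_ord //; ring.
by rewrite big_ord_recr /= IHn [in X in _ = X + _]big_ord_recr /= /gauss_sum key; ring.
Qed.

(** By [dseqB], d_(2i) / (1 - q^(2i)) is 2 q^(2i) u_(2i) / (1 - q^(2i))^2, and [gauss_sumE] expands
    u_(2i). *)
Lemma Ysum_even n :
  Ysum R (predC odd) (2 * n) =
  2%:R * \sum_(i < n) Q ^+ i.+1 / (1 - Q ^+ i.+1) ^+ 2 * gauss_sum i.+1 i.+1.
Proof.
elim: n => [|n IHn]; first by rewrite /Ysum muln0 !big_ord0 mulr0.
have -> : (2 * n.+1 = (2 * n).+2)%N by lia.
rewrite {1}/Ysum big_mkcond 2!big_ord_recr /= -big_mkcond /= -[X in X + _ + _]/(Ysum R (predC odd) (2 * n)) IHn.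
have -> : odd (2 * n) = false by rewrite oddM.
rewrite /= addr0 [in RHS]big_ord_recr /= mulrDr; congr (_ + _).
have QE : Q ^+ n.+1 = q ^+ (2 * n).+2 by rewrite -exprM; congr (_ ^+ _); lia.
have u1 : 1 - q ^+ (2 * n).+2 \is a GRing.unit by apply: unit_qB.
rewrite gauss_sumE QE mulrA; have -> : (2 * n.+1 = (2 * n).+2)%N by lia.
rewrite -[LHS]mulr1 mulrA; apply: eq_divM => //; first exact: unitrX.
by rewrite mulr1 expr2 mulrA dseqB.
Qed.

Lemma divr_sqr_expand (x : fps R) n : 1 - x \is a GRing.unit ->
  x / (1 - x) ^+ 2 = \sum_(k < n) k.+1%:R * x ^+ k.+1 +
     x ^+ n.+1 * ((n.+1%:R - n%:R * x) / (1 - x) ^+ 2).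
Proof.
move=> u1; have u2 := unitrX 2 u1; elim: n => [|n IHn].
  by rewrite big_ord0; ring.
rewrite IHn big_ord_recr /= -addrA; congr (_ + _).
have cancel (a b c d e D : fps R) : D \is a GRing.unit ->
    a * b = c * D + d * e -> a * (b / D) = c + d * (e / D).
  by move=> Du E; rewrite !mulrA E mulrDl mulrK.
by apply: cancel => //; rewrite !exprS; ring.
Qed.

(** The least exponent among the factors is that of 1 - Q^(n-r+1). *)
Lemma bailey_ordge n r : ordge (2 * (n.+1 - r)) (bailey n r - 1).
Proof.
elim: r => [|r IHr]; first by rewrite bailey0 subrr; apply: ordge_0.
have u1 : 1 - Q ^+ (n + r.+1) \is a GRing.unit by rewrite unitQ // addnS.
apply: (ordge_mulI u1); rewrite mulrBl baileyS mul1r.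
have -> : bailey n r * (1 - Q ^+ (n - r)) - (1 - Q ^+ (n + r.+1)) =
  (bailey n r - 1) - bailey n r * Q ^+ (n - r) + Q ^+ (n + r.+1) by ring.
apply: ordgeD; first apply: ordgeB.
- by apply: (ordge_le IHr); lia.
- by apply: ordgeMl; rewrite -exprM; apply: ordge_qle; lia.
- by rewrite -exprM; apply: ordge_qle; lia.
Qed.

(** Gauss's theta identity, truncated. Replacing [bailey n a] by 1 costs order a^2 + 2 (n + 1 - a),
    which is at least 2n + 1 because (a - 1)^2 >= 0. *)
Lemma useq_theta n :
  ordge (2 * n).+1 (useq R (2 * n) - (1 + 2%:R * \sum_(r < n) (-1) ^+ r.+1 * q ^+ (r.+1 ^ 2))).
Proof.
rewrite -gauss_sumE /gauss_sum opprD addrACA subrr add0r -mulrBr -sumrB.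
apply/ordgeMl/ordge_sum => r _.
rewrite -[X in _ - X]mulr1 -mulrBr; apply: ordge_le (ordgeM (ordgeMl _ (ordge_q _ _)) (bailey_ordge _ _)) _.
have := ltn_ord r; nia.
Qed.

(** The Appell-Lerch form: in [sum_bailey] the factors [bailey] are replaced by 1 and Q^r / (1 -
    Q^r)^2 is expanded in powers of Q^r; both errors lie beyond q^(2n). *)
Lemma Ysum_even_expand n :
  ordge (2 * n).+1 (Ysum R (predC odd) (2 * n) -
   (2%:R * \sum_(i < n) \sum_(k < n) k.+1%:R * q ^+ (2 * i.+1 * k.+1) +
    4%:R * \sum_(r < n) \sum_(k < n) (-1) ^+ r.+1 * k.+1%:R * q ^+ (r.+1 ^ 2 + 2 * r.+1 * k.+1))).
Proof.
have expand i : ordge (2 * i.+1 * n.+1) (Q ^+ i.+1 / (1 - Q ^+ i.+1) ^+ 2 -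
   \sum_(k < n) k.+1%:R * q ^+ (2 * i.+1 * k.+1)).
  rewrite (divr_sqr_expand n (unitQ (ltn0Sn i))).
  have Qx k : (Q ^+ i.+1) ^+ k = q ^+ (2 * i.+1 * k) by rewrite -!exprM mulnA.
  under eq_bigr => k _ do rewrite Qx.
  by rewrite addrAC subrr add0r Qx; apply/ordgeMr/ordge_q.
rewrite Ysum_even sum_bailey mulrDr opprD addrACA -mulrBr -sumrB.
apply: ordgeD.
  by apply/ordgeMl/ordge_sum => i _; apply: (ordge_le (expand i)); lia.
rewrite mulrA -natrM -mulrBr -sumrB; apply/ordgeMl/ordge_sum => r _.
pose t := (-1) ^+ r.+1 * q ^+ (r.+1 ^ 2).
have -> : \sum_(k < n) (-1) ^+ r.+1 * k.+1%:R * q ^+ (r.+1 ^ 2 + 2 * r.+1 * k.+1) =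
   t * \sum_(k < n) k.+1%:R * q ^+ (2 * r.+1 * k.+1).
  by rewrite mulr_sumr; apply: eq_bigr => k _; rewrite exprD /t; ring.
have to : ordge (r.+1 ^ 2) t by apply/ordgeMl/ordge_q.
set S := \sum_(k < n) _; set X := Q ^+ r.+1 / _.
have -> : t * (X * bailey n r.+1) - t * S = t * X * (bailey n r.+1 - 1) + t * (X - S) by ring.
apply: ordgeD.
  have Xo : ordge (2 * r.+1) X by apply: ordgeMr; rewrite -exprM; apply: ordge_q.
  by apply: ordge_le (ordgeM (ordgeM to Xo) (bailey_ordge _ _)) _; have := ltn_ord r; nia.
by apply: ordge_le (ordgeM to (expand r)) _; nia.
Qed.

End Bailey.

(** * Logarithmic derivative of u modulo 3 *)

Section ThetaUseq.
Local Open Scope ring_scope.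
Variable R : comNzRingType.
Local Notation q := (fpsX R).

Lemma theta_useq M :
  theta (useq R M) = - useq R M *
    \sum_(m < M) m.+1%:R * (q ^+ m.+1 / (1 - q ^+ m.+1) + q ^+ m.+1 / (1 + q ^+ m.+1)).
Proof.
elim: M => [|M IHM]; first by rewrite big_ord0 mulr0 useq0 theta1.
have u1 : 1 - q ^+ M.+1 \is a GRing.unit by apply: unit_qB.
have u2 : 1 + q ^+ M.+1 \is a GRing.unit by apply: unit_qD.
apply: (mulIr u2); rewrite big_ord_recr /=; set S := \sum_(m < M) _ in IHM *.
have := congr1 (@theta R) (useqS R M).
rewrite (thetaM (useq R M.+1)) (thetaM (useq R M)) thetaD thetaB theta1 thetaXn add0r sub0r IHM.
have := useqS R M; set Z := q ^+ M.+1 in u1 u2 *; move: (useq R M) => u E T.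
apply: (addIr (useq R M.+1 * (M.+1%:R * Z))); rewrite T.
have -> : - useq R M.+1 * (S + M.+1%:R * (Z / (1 - Z) + Z / (1 + Z))) * (1 + Z) =
  - (useq R M.+1 * (1 + Z)) * (S + M.+1%:R * (Z / (1 - Z))) -
  useq R M.+1 * M.+1%:R * Z * ((1 + Z) / (1 + Z)) by ring.
rewrite E divrr //.
have -> : - (u * (1 - Z)) * (S + M.+1%:R * (Z / (1 - Z))) =
  - u * (1 - Z) * S - u * (M.+1%:R * Z) * ((1 - Z) / (1 - Z)) by ring.
by rewrite divrr //; ring.
Qed.

Lemma divr_expand (x : fps R) n : 1 - x \is a GRing.unit ->
  x / (1 - x) = \sum_(k < n) x ^+ k.+1 + x ^+ n.+1 / (1 - x).
Proof.
move=> u1; elim: n => [|n IHn]; first by rewrite big_ord0 add0r.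
rewrite IHn big_ord_recr /= -addrA; congr (_ + _); apply: (mulIr u1).
by rewrite mulrDl !divrK // !exprS; ring.
Qed.

Definition lambert1 c M : fps R :=
  \sum_(m < M) m.+1%:R * ((q ^+ c) ^+ m.+1 / (1 - (q ^+ c) ^+ m.+1)).
Definition lambert2 c M : fps R :=
  \sum_(m < M) (q ^+ c) ^+ m.+1 / (1 - (q ^+ c) ^+ m.+1) ^+ 2.

(** Both are truncations of sum_n sigma(n) q^(cn), sigma being the sum of divisors: each expands to
    a double sum of m q^(cmk), with the two indices exchanged. *)
Lemma lambert_swap c M : (0 < c)%N -> ordge M.+1 (lambert1 c M - lambert2 c M).
Proof.
move=> c_gt0; pose D : fps R := \sum_(m < M) \sum_(k < M) m.+1%:R * q ^+ (c * (m.+1 * k.+1)).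
have u m : 1 - (q ^+ c) ^+ m.+1 \is a GRing.unit by rewrite -exprM unit_qB // muln_gt0 c_gt0.
have qE m k : (q ^+ c) ^+ m.+1 ^+ k.+1 = q ^+ (c * (m.+1 * k.+1)) by rewrite -!exprM mulnA.
have small m : ordge M.+1 ((q ^+ c) ^+ m.+1 ^+ M.+1).
  by rewrite qE; apply: ordge_qle; nia.
have E1 : ordge M.+1 (lambert1 c M - D).
  rewrite /lambert1 /D -sumrB; apply: ordge_sum => m _; rewrite -mulr_sumr -mulrBr; apply: ordgeMl.
  rewrite (divr_expand M (u m)); under eq_bigr do rewrite qE.
  by rewrite addrAC subrr add0r; apply: ordgeMr.
have E2 : ordge M.+1 (lambert2 c M - D).
  rewrite /lambert2 /D exchange_big -sumrB; apply: ordge_sum => m _ /=.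
  rewrite (divr_sqr_expand M (u m)).
  under [X in _ - X]eq_bigr do rewrite [(_ * m.+1)%N]mulnC -qE.
  by rewrite addrAC subrr add0r; apply: ordgeMr.
by have := ordgeB E1 E2; rewrite opprB addrA subrK.
Qed.

(** For x = q^m, x/(1-x) + x/(1+x) = 2 (x/(1-x) - x^2/(1-x^2)) and x/(1+x)^2 = x/(1-x)^2 - 4
    x^2/(1-x^2)^2. After [lambert_swap] the discrepancy is the coefficient 4 against 1, a multiple
    of 3. *)
Lemma theta_useq_mod3 M : 3%:R = 0 :> R ->
  ordge M.+1 (theta (useq R M) +
    2%:R * useq R M * \sum_(j < M) q ^+ j.+1 / (1 + q ^+ j.+1) ^+ 2).
Proof.
move=> R3.
have F3 f : 3%:R * f = 0 :> fps R.
  by apply/fpsP => n; rewrite coefs_natl R3 mul0r.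
have u1 m : 1 - q ^+ m.+1 \is a GRing.unit by apply: unit_qB.
have u2 m : 1 + q ^+ m.+1 \is a GRing.unit by apply: unit_qD.
have factor m : 1 - (q ^+ 2) ^+ m.+1 = (1 - q ^+ m.+1) * (1 + q ^+ m.+1).
  by rewrite -exprM mulnC exprM; ring.
have L1 : \sum_(m < M) m.+1%:R * (q ^+ m.+1 / (1 - q ^+ m.+1) + q ^+ m.+1 / (1 + q ^+ m.+1)) =
  2%:R * lambert1 1 M - 2%:R * lambert1 2 M.
  rewrite -mulrBr /lambert1 -sumrB mulr_sumr; apply: eq_bigr => m _; rewrite -mulrBr mulrCA expr1; congr (_ * _).
  rewrite factor -exprM mulnC exprM; move: (u1 m) (u2 m); set x := q ^+ m.+1 => v1 v2.
  apply: (mulIr v1); apply: (mulIr v2); rewrite invrM //.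
  have := mulVr v1; have := mulVr v2; move: ((1 + x)^-1) ((1 - x)^-1) => b a Eb Ea.
  transitivity (x * (a * (1 - x)) * (1 + x) + x * (1 - x) * (b * (1 + x))); first by ring.
  transitivity (2%:R * (x * (a * (1 - x)) * (1 + x) - x ^+ 2 * ((a * (1 - x)) * (b * (1 + x))))); last by ring.
  by rewrite Ea Eb; ring.
have L2 : \sum_(j < M) q ^+ j.+1 / (1 + q ^+ j.+1) ^+ 2 = lambert2 1 M - 4%:R * lambert2 2 M.
  rewrite /lambert2 mulr_sumr -sumrB; apply: eq_bigr => m _; rewrite expr1.
  rewrite factor -exprM mulnC exprM; move: (u1 m) (u2 m); set x := q ^+ m.+1 => v1 v2.
  have w1 := unitrX 2 v1; have w2 := unitrX 2 v2.
  apply: (mulIr w1); apply: (mulIr w2).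
  rewrite exprMn (invrM w1 w2).
  have := mulVr w1; have := mulVr w2; move: (((1 + x) ^+ 2)^-1) (((1 - x) ^+ 2)^-1) => b a Eb Ea.
  transitivity (x * (1 - x) ^+ 2 * (b * (1 + x) ^+ 2)); first by ring.
  transitivity (x * (a * (1 - x) ^+ 2) * (1 + x) ^+ 2 -
    4%:R * x ^+ 2 * ((a * (1 - x) ^+ 2) * (b * (1 + x) ^+ 2))); last by ring.
  by rewrite Ea Eb; ring.
rewrite theta_useq L1 L2.
have := lambert_swap M (ltn0Sn 0); have := lambert_swap M (ltn0Sn 1).
move: (lambert1 1 M) (lambert1 2 M) (lambert2 1 M) (lambert2 2 M) => a b a' b' bb aa.
have -> : - useq R M * (2%:R * a - 2%:R * b) + 2%:R * useq R M * (a' - 4%:R * b') =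
  - 2%:R * useq R M * (a - a') + 2%:R * useq R M * (b - b') - 3%:R * (2%:R * useq R M * b') by ring.
by rewrite F3 subr0; apply: ordgeD; apply: ordgeMl.
Qed.

End ThetaUseq.

(** * The ternary form a^2 + 2uv modulo 3 *)

Section Ternary.
Local Open Scope ring_scope.

(** Reindexing inside one finite list: the maps must stay in the list and be mutually inverse only
    where the predicates hold. *)
Lemma sum_bij (V : nmodType) (T : eqType) (B : seq T) (P P' : pred T) (h h' : T -> T)
    (F F' : T -> V) : uniq B ->
  {in B, forall t, P t -> [/\ h t \in B, P' (h t), h' (h t) = t & F t = F' (h t)]} ->
  {in B, forall t, P' t -> [/\ h' t \in B, P (h' t) & h (h' t) = t]} ->
  \sum_(t <- B | P t) F t = \sum_(t <- B | P' t) F' t.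
Proof.
move=> uB hP hP'; rewrite -big_filter -[RHS]big_filter.
have memP t : t \in filter P B -> [/\ h t \in filter P' B, h' (h t) = t & F t = F' (h t)].
  by rewrite !mem_filter => /andP[Pt Bt]; case: (hP t Bt Pt) => -> -> -> ->.
rewrite [RHS](perm_big [seq h t | t <- filter P B]) ?big_map /=; last first.
  apply: uniq_perm; rewrite ?filter_uniq ?map_inj_in_uniq ?filter_uniq //.
    by move=> s t /memP[_ hs _] /memP[_ ht _] e; rewrite -hs -ht e.
  move=> t; apply/idP/mapP => [|[s /memP[hs _ _] ->]]; last by [].
  by rewrite mem_filter => /andP[P't Bt]; case: (hP' t Bt P't) => *; exists (h' t); rewrite ?mem_filter; try apply/andP.
by apply: eq_big_seq => t /memP[].
Qed.

Definition posz_range I : seq int := [seq i.+1%:Z | i <- iota 0 I].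
Definition int_range I : seq int := 0 :: posz_range I ++ [seq - a | a <- posz_range I].
Definition triples I : seq (int * (int * int)) :=
  [seq (a, p) | a <- int_range I, p <- [seq (u, v) | u <- posz_range I, v <- posz_range I]].

Lemma mem_posz_range I u : (u \in posz_range I) = (0 < u <= I%:Z).
Proof.
apply/mapP/idP => [[i]|uI]; first by rewrite mem_iota => ? ->; lia.
by exists (absz u).-1; [rewrite mem_iota | ]; lia.
Qed.

Lemma mem_int_range I a : (a \in int_range I) = (- I%:Z <= a <= I%:Z).
Proof.
rewrite inE mem_cat mem_posz_range -[a in a \in map _ _]opprK (mem_map oppr_inj) mem_posz_range.
lia.
Qed.

Lemma mem_triples I a u v : ((a, (u, v)) \in triples I) =
  [&& - I%:Z <= a <= I%:Z, 0 < u <= I%:Z & 0 < v <= I%:Z].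
Proof.
rewrite -mem_int_range -!mem_posz_range; apply/idP/and3P => [|[aI uI vI]].
  by case/allpairsP => [[a' p] [/= aI /allpairsP[[u' v'] [/= uI vI ->]] [-> -> ->]]].
by rewrite allpairs_f // allpairs_f.
Qed.

Lemma uniq_triples I : uniq (triples I).
Proof.
have up : uniq (posz_range I).
  by rewrite map_inj_uniq ?iota_uniq // => i j [].
apply: allpairs_uniq; last by move=> [? ?] [? ?] _ _ [-> ->].
- rewrite /= cat_uniq up map_inj_uniq ?up /=; last exact: oppr_inj.
  rewrite andbT mem_cat mem_posz_range ltxx /=; apply/andP; split.
    by rewrite -oppr0 (mem_map oppr_inj) mem_posz_range ltxx.
  apply/hasPn => a; rewrite -[a]opprK (mem_map oppr_inj) !mem_posz_range; lia.
- by apply: allpairs_uniq => // [[? ?] [? ?] _ _ [-> ->]].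
Qed.

Variable R : comNzRingType.
Hypothesis R3 : 3%:R = 0 :> R.

Let mul3i (x : int) : (3 * x)%:~R = 0 :> R.
Proof. by rewrite intrM rmorph_nat R3 mul0r. Qed.

(** Fermat's little theorem for the prime 3. *)
Let cube (x : int) : (x * x * x)%:~R = x%:~R :> R.
Proof.
have [y ->] : exists y, x * x * x = x + 3 * y.
  have [k [r [xE rE]]] : exists k r : int, x = 3 * k + r /\ (r = 0 \/ r = 1 \/ r = -1).
    by exists ((x + 1) %/ 3)%Z, (x - 3 * ((x + 1) %/ 3)%Z); split; lia.
  exists (9 * k * k * k + 9 * k * k * r + 3 * k * r * r - k); rewrite xE.
  by case: rE => [|[]] ->; ring.
by rewrite intrD mul3i addr0.
Qed.

Let mul3 (x : R) : 3%:R * x = 0. Proof. by rewrite R3 mul0r. Qed.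

Let half (x : R) : x = - x -> x = 0.
Proof.
move=> e; have -> : x = 3%:R * x - (x + x) by ring.
by rewrite mul3 sub0r {2}e subrr oppr0.
Qed.

Variables (N I : nat).
Hypothesis le_NI : (N <= I)%N.

(** [w] and [g] replace [F1] and [F2] modulo 3; they transform simply under automorphisms of the
    form. *)
Let w (t : int * (int * int)) : R :=
  let: (a, (u, v)) := t in ((u + v) * ((u - v) * (u - v) - a * a))%:~R.
Let g (t : int * (int * int)) : R :=
  let: (a, (r, k)) := t in (k * ((k + r) * (k + r) - a * a))%:~R.
Let E1 (t : int * (int * int)) : bool :=
  let: (a, (u, v)) := t in a * a + 2 * u * v == N%:Z.
Let E2 (t : int * (int * int)) : bool :=
  let: (a, (r, k)) := t in a * a + (r * r + 2 * r * k) == N%:Z.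
(** [F1] and [F2] are, up to sign, the coefficients in u theta Y - Y theta u + u Y: a coefficient of
    Y times one plus the exponent from Y minus the exponent from u. *)
Let F1 (t : int * (int * int)) : R :=
  let: (a, (u, v)) := t in (2 * v * (2 * u * v + 1 - a * a))%:~R.
Let F2 (t : int * (int * int)) : R :=
  let: (a, (r, k)) := t in (4 * k * (r * r + 2 * r * k + 1 - a * a))%:~R.

Let F2g t : F2 t = g t.
Proof.
case: t => a [r k]; rewrite /F2 /g.
have -> : 4 * k * (r * r + 2 * r * k + 1 - a * a) = k * ((k + r) * (k + r) - a * a) +
  (3 * (k + k * (r * r) + 2 * (k * (r * k)) - k * (a * a)) + (k - k * k * k)) by ring.
by rewrite intrD [X in _ + X]intrD mul3i intrB cube subrr !addr0.
Qed.

(** The form is symmetric in [u] and [v], so [F1] may be averaged with its image; Fermat's theorem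
    for u + v makes the average [w]. *)
Let sumF1 : \sum_(t <- triples I | E1 t) F1 t = \sum_(t <- triples I | E1 t) w t.
Proof.
pose sw (t : int * (int * int)) := let: (a, (u, v)) := t in (a, (v, u)).
have swE : \sum_(t <- triples I | E1 t) F1 t = \sum_(t <- triples I | E1 t) F1 (sw t).
  apply: (sum_bij (h := sw) (h' := sw) (uniq_triples I)) => [] [a [u v]]; rewrite /sw /E1 !mem_triples => H E;
    split=> //; lia.
have : \sum_(t <- triples I | E1 t) (F1 t + F1 (sw t)) = \sum_(t <- triples I | E1 t) (w t + w t).
  apply: eq_bigr => [] [a [u v]] _; rewrite /F1 /w /sw -[LHS]intrD -[RHS]intrD.
  have -> : 2 * v * (2 * u * v + 1 - a * a) + 2 * u * (2 * v * u + 1 - a * a) =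
    2 * ((u + v) - (u + v) * (u + v) * (u + v)) + (3 * (4 * (u * v * (u + v))) +
    ((u + v) * ((u - v) * (u - v) - a * a) + (u + v) * ((u - v) * (u - v) - a * a))) by ring.
  by rewrite [LHS]intrD intrM intrB cube subrr mulr0 add0r [LHS]intrD mul3i add0r.
rewrite !big_split /= -swE; move: (\sum_(_ <- _ | _) _) (\sum_(_ <- _ | _) _) => y x e.
apply/eqP; rewrite -subr_eq0; apply/eqP/half.
by transitivity ((x + x) - x - y); [ring | rewrite e; ring].
Qed.

(* Exchanging k + r and a preserves the form and changes the sign of g. *)
Let sum_gt : \sum_(t <- triples I | E2 t && (t.2.2 < t.1)) g t = 0.
Proof.
apply: half; rewrite -sumrN.
pose h (t : int * (int * int)) := let: (a, (r, k)) := t in (r + k, (a - k, k)).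
apply: (sum_bij (h := h) (h' := h) (uniq_triples I)) => [] [a [r k]]; rewrite /h /E2 !mem_triples /= => H E.
  split; first (by nia); first (by nia); first by congr (_, (_, _)); lia.
  by rewrite /g -intrN; congr (_ %:~R); ring.
by split; [nia | nia | congr (_, (_, _)); lia].
Qed.

(** For a = k the form is (k + r)^2; exchanging [k] and [r] changes the sign of [g] modulo 3. *)
Let sum_eq : \sum_(t <- triples I | E2 t && (t.1 == t.2.2)) g t = 0.
Proof.
apply: half; rewrite -sumrN.
pose h (t : int * (int * int)) := let: (a, (r, k)) := t in (r, (k, r)).
apply: (sum_bij (h := h) (h' := h) (uniq_triples I)) => [] [a [r k]]; rewrite /h /E2 !mem_triples /= => H /andP[E /eqP ak];
  rewrite ?{}ak in H E *.
  split; first (by lia); first (by nia); first by congr (_, (_, _)); lia.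
  rewrite /g -intrN.
  have -> : k * ((k + r) * (k + r) - k * k) = 3 * (r * k * (k + r)) + - (r * ((r + k) * (r + k) - r * r)) by ring.
  by rewrite intrD mul3i add0r.
by split; [lia | nia | congr (_, (_, _)); lia].
Qed.

(** The substitution (a + r, r, k - a) carries one form to the other. The condition a < k becomes v
    > 0, k > 0 becomes u - v < a, and the weights agree modulo 3. *)
Let sum_lt : \sum_(t <- triples I | E2 t && (t.1 < t.2.2)) g t =
  \sum_(t <- triples I | E1 t && (t.2.1 - t.2.2 < t.1)) w t.
Proof.
pose h (t : int * (int * int)) := let: (a, (r, k)) := t in (a + r, (r, k - a)).
pose h' (t : int * (int * int)) := let: (a, (u, v)) := t in (a - u, (u, v + a - u)).
apply: (sum_bij (h := h) (h' := h') (uniq_triples I)) => [] [a [r k]]; rewrite /h /h' /E1 /E2 !mem_triples /= => H E.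
  split; first (by nia); first (by nia); first by congr (_, (_, _)); lia.
  rewrite /g /w.
  have -> : k * ((k + r) * (k + r) - a * a) = 3 * ((a + r) * k * (k + r - a)) +
     (r + (k - a)) * ((r - (k - a)) * (r - (k - a)) - (a + r) * (a + r)) by ring.
  by rewrite intrD mul3i add0r.
by split; [nia | nia | congr (_, (_, _)); lia].
Qed.

(** The [F2] sum reduces to the sum S of [w] over u - v < a. The reflection (-a, v, u) shows that u
    - v > a also gives S, and [w] vanishes for a = u - v; the total is 3S. *)
Lemma ternary_sum :
  \sum_(t <- triples I | E1 t) F1 t + \sum_(t <- triples I | E2 t) F2 t = 0.
Proof.
rewrite sumF1 (eq_bigr _ (fun t _ => F2g t)).
have -> : \sum_(t <- triples I | E2 t) g t = \sum_(t <- triples I | E1 t && (t.2.1 - t.2.2 < t.1)) w t.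
  rewrite -sum_lt (bigID (fun t => t.1 < t.2.2)) /= [X in _ + X](bigID (fun t => t.1 == t.2.2)) /=.
  have -> : \sum_(t <- triples I | E2 t && ~~ (t.1 < t.2.2) && (t.1 == t.2.2)) g t = 0.
    by rewrite -[RHS]sum_eq; apply: eq_bigl => t; case: ltgtP; rewrite ?andbF ?andbT.
  have -> : \sum_(t <- triples I | E2 t && ~~ (t.1 < t.2.2) && (t.1 != t.2.2)) g t = 0.
    by rewrite -[RHS]sum_gt; apply: eq_bigl => t; case: ltgtP; rewrite ?andbF ?andbT.
  by rewrite !addr0.
set S := \sum_(t <- triples I | _ && _) w t.
suff -> : \sum_(t <- triples I | E1 t) w t = S + S by rewrite -(mul3 S); ring.
rewrite (bigID (fun t => t.2.1 - t.2.2 < t.1)) /= -/S; congr (_ + _).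
rewrite (bigID (fun t => t.1 == t.2.1 - t.2.2)) /= big1 ?add0r => [|[a [u v]]]; last first.
  by case/andP=> _ /eqP /= ->; rewrite /w subrr mulr0.
pose h (t : int * (int * int)) := let: (a, (u, v)) := t in (- a, (v, u)).
apply: (sum_bij (h := h) (h' := h) (uniq_triples I)) => [] [a [u v]]; rewrite /h /E1 !mem_triples /= => H E.
  split; first (by lia); first (by nia); first by rewrite opprK.
  by rewrite /w; congr (_ %:~R); ring.
by split; [lia | nia | rewrite opprK].
Qed.

End Ternary.

(** * The differential relation between u and Y_even modulo 3 *)

Section EvenPart.
Local Open Scope ring_scope.

Lemma sum_posz_range (V : nmodType) I (F : int -> V) :
  \sum_(a <- posz_range I) F a = \sum_(i < I) F i.+1%:Z.
Proof. by rewrite big_map -{1}[I]subn0 -/(index_iota 0 I) big_mkord. Qed.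

Lemma sum_triples (V : nmodType) I (F : int * (int * int) -> V) :
  \sum_(t <- triples I) F t =
  \sum_(a <- int_range I) \sum_(i < I) \sum_(j < I) F (a, (i.+1%:Z, j.+1%:Z)).
Proof.
rewrite big_allpairs; apply: eq_bigr => a _; rewrite big_allpairs sum_posz_range.
by apply: eq_bigr => i _; rewrite sum_posz_range.
Qed.

Variable R : comNzRingType.
Local Notation q := (fpsX R).

Lemma coefs_intl (c : int) (f : fps R) n : coefs (c%:~R * f) n = c%:~R * coefs f n.
Proof.
by case: c => m; rewrite ?NegzE ?mulrNz ?mulNr ?coefsN -!pmulrn coefs_natl.
Qed.

Let mono (c : int) e : fps R := c%:~R * q ^+ e.

Let coefs_mono c e n : coefs (mono c e) n = if n == e then c%:~R else 0.
Proof. by rewrite coefs_intl coefsXn; case: eqP; rewrite (mulr1, mulr0). Qed.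

Let theta_mono c e : theta (mono c e) = mono (e%:Z * c) e.
Proof.
apply/fpsP => n; rewrite coefs_theta !coefs_mono; case: eqP => [->|_]; last by rewrite mulr0.
by rewrite intrM.
Qed.

Let monoM c d e e' : mono c e * mono d e' = mono (c * d) (e + e').
Proof. by rewrite /mono intrM exprD; ring. Qed.

Let sgn (a : int) : int := (-1) ^+ `|a|.
Let sgn_odd a n : odd `|a| = odd n -> sgn a = (-1) ^+ n.
Proof. by rewrite /sgn -signr_odd => ->; rewrite signr_odd. Qed.

Let thetaE I : 1 + 2%:R * \sum_(r < I) (-1) ^+ r.+1 * q ^+ (r.+1 ^ 2) =
  \sum_(a <- int_range I) mono (sgn a) (`|a| * `|a|).
Proof.
rewrite big_cons big_cat [X in _ + (_ + X)]big_map /= -big_split /= sum_posz_range /mono /sgn /= !mul1r.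
congr (_ + _); rewrite mulr_sumr; apply: eq_bigr => r _ /=.
by rewrite rmorphXn rmorphN1 /= mulnn; ring.
Qed.

Let evenE I :
  2%:R * \sum_(i < I) \sum_(k < I) k.+1%:R * q ^+ (2 * i.+1 * k.+1) +
  4%:R * \sum_(r < I) \sum_(k < I) (-1) ^+ r.+1 * k.+1%:R * q ^+ (r.+1 ^ 2 + 2 * r.+1 * k.+1) =
  \sum_(i < I) \sum_(k < I) (mono (2 * k.+1%:Z) (2 * i.+1 * k.+1) +
    mono (4 * sgn i.+1 * k.+1%:Z) (i.+1 * i.+1 + 2 * i.+1 * k.+1)).
Proof.
rewrite !mulr_sumr -big_split; apply: eq_bigr => i _ /=.
rewrite !mulr_sumr -big_split; apply: eq_bigr => k _ /=.
by rewrite /mono !intrM rmorphXn rmorphN1 /= mulnn !rmorph_nat !mulrA.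
Qed.

Hypothesis R3 : 3%:R = 0 :> R.

(** Since theta multiplies a monomial by its exponent, multiplying out gives the weights of
    [ternary_sum]. The sign is (-1)^N throughout, because a, respectively a + u, has the parity of
    N. *)
Let even_support_coefs I N : (N <= I)%N ->
  let Th := \sum_(a <- int_range I) mono (sgn a) (`|a| * `|a|) in
  let Y := \sum_(i < I) \sum_(k < I) (mono (2 * k.+1%:Z) (2 * i.+1 * k.+1) +
    mono (4 * sgn i.+1 * k.+1%:Z) (i.+1 * i.+1 + 2 * i.+1 * k.+1)) in
  coefs (Th * theta Y - Y * theta Th + Th * Y) N = 0.
Proof.
move=> le_NI Th Y.
pose c1 (t : int * (int * int)) := let: (a, (u, v)) := t in 2 * v * (2 * u * v + 1 - a * a).
pose c2 (t : int * (int * int)) := let: (a, (u, v)) := t in 4 * v * (u * u + 2 * u * v + 1 - a * a).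
have -> : Th * theta Y - Y * theta Th + Th * Y =
  \sum_(t <- triples I) (mono (sgn t.1 * c1 t) (`|t.1| * `|t.1| + 2 * `|t.2.1| * `|t.2.2|) +
    mono (sgn t.1 * sgn t.2.1 * c2 t) (`|t.1| * `|t.1| + (`|t.2.1| * `|t.2.1| + 2 * `|t.2.1| * `|t.2.2|))).
  have -> : Th * theta Y - Y * theta Th + Th * Y = Th * (theta Y + Y) - theta Th * Y by ring.
  rewrite sum_triples /Th /Y !theta_sum !mulr_suml -sumrB; apply: eq_bigr => a _.
  rewrite -big_split !mulr_sumr -sumrB; apply: eq_bigr => i _ /=.
  rewrite theta_sum -big_split !mulr_sumr -sumrB; apply: eq_bigr => k _ /=.
  rewrite !thetaD !theta_mono ![mono (sgn a) _ * _]mulrDr ![mono (_ * sgn a) _ * _]mulrDr !monoM.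
  have aE : (`|a| * `|a|)%N = a * a :> int by rewrite PoszM !abszE -expr2 real_normK ?num_real.
  by rewrite /mono aE !(PoszD, PoszM) !intrM !(intrD, intrN, intrM) !exprD; ring.
rewrite coefs_sum.
transitivity ((-1) ^+ N * (\sum_(t <- triples I | let: (a, (u, v)) := t in a * a + 2 * u * v == N%:Z) (c1 t)%:~R +
   \sum_(t <- triples I | let: (a, (u, v)) := t in a * a + (u * u + 2 * u * v) == N%:Z) (c2 t)%:~R) : R); last first.
  have := ternary_sum R3 le_NI; rewrite /c1 /c2 => E.
  rewrite -[RHS](mulr0 ((-1) ^+ N)) -[in RHS]E; congr (_ * (_ + _)); by apply: eq_bigr => [] [a [u v]].
rewrite mulrDr !mulr_sumr [X in _ = X + _]big_mkcond [X in _ = _ + X]big_mkcond -big_split /=.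
apply: eq_big_seq => [] [a [u v]]; rewrite mem_triples => /and3P[_ /andP[u_gt0 _] /andP[v_gt0 _]] /=.
have -> : (a * a + 2 * u * v == N%:Z) = (N == `|a| * `|a| + 2 * `|u| * `|v|)%N by nia.
have -> : (a * a + (u * u + 2 * u * v) == N%:Z) = (N == `|a| * `|a| + (`|u| * `|u| + 2 * `|u| * `|v|))%N by nia.
rewrite coefsD !coefs_mono; congr (_ + _); case: eqP => // NE.
  rewrite intrM (@sgn_odd a N) ?rmorphXn ?rmorphN1 //.
  by rewrite NE !oddD !oddM /= addbF andbb.
have -> : sgn a * sgn u = (-1) ^+ N.
  rewrite /sgn -exprD -[LHS]signr_odd -[RHS]signr_odd NE !oddD !oddM /= addbF.
  by rewrite !andbb.
by rewrite intrM rmorphXn rmorphN1.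
Qed.

(** u and Y_even are replaced by their explicit expansions; theta and products keep the errors
    divisible by q^(I+1). *)
Lemma even_part_theta I :
  let u := useq R (2 * I) in let Y := Ysum R (predC odd) (2 * I) in
  ordge I.+1 (u * theta Y - Y * theta u + u * Y).
Proof.
move=> u Y; have := useq_theta R I; have := Ysum_even_expand R I.
rewrite thetaE evenE.
have := @even_support_coefs I.
set T := \sum_(a <- _) _; set Z := \sum_(i < I) _ => /= key; rewrite -/u -/Y => YZ uT.
have {}YZ : ordge I.+1 (Y - Z) by apply: (ordge_le YZ); lia.
have {}uT : ordge I.+1 (u - T) by apply: (ordge_le uT); lia.
have -> : u * theta Y - Y * theta u + u * Y =
  (T * theta Z - Z * theta T + T * Z) +
  ((u - T) * (theta Y + Y) + T * (theta (Y - Z) + (Y - Z)) - (Y - Z) * theta u - Z * theta (u - T)).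
  by rewrite !thetaB; ring.
apply: ordgeD; first by constructor=> n; rewrite ltnS; apply: key.
apply: ordgeB; last by apply/ordgeMl/ordge_theta.
apply: ordgeB; last by apply: ordgeMr.
apply: ordgeD; first exact: ordgeMr.
by apply/ordgeMl/ordgeD => //; apply: ordge_theta.
Qed.

End EvenPart.

(** * Combination of the four facts *)

Section ThetaAlpha.
Local Open Scope ring_scope.
Variable R : comNzRingType.
Hypothesis R3 : 3%:R = 0 :> R.
Local Notation q := (fpsX R).

Lemma theta_Hsum I :
  ordge I.+1 (useq R (2 * I) * theta (Hsum (2 * I) (-1)) - Ysum R odd (2 * I)).
Proof.
have V := useq_Hsum R (2 * I); have III := Ysum_signed R (2 * I).
have VI := theta_useq_mod3 (2 * I) R3; have IV := even_part_theta R3 I.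
set u := useq R (2 * I) in V VI IV *; set A := Hsum _ _ in V *.
set Ye := Ysum R (predC odd) (2 * I) in V IV; set Yo := Ysum R odd (2 * I).
set L := \sum_(j < 2 * I) q ^+ _ / _ in III VI.
have YE : \sum_(m < 2 * I) (-1) ^+ m.+1 * dseq R m / (1 - q ^+ m.+1) = Ye - Yo.
  rewrite /Ye /Yo /Ysum [X in _ = X - _]big_mkcond [X in _ = _ - X]big_mkcond -sumrB.
  apply: eq_bigr => m _ /=; rewrite -signr_odd /=.
  by case: odd; rewrite /= ?expr0 ?expr1; ring.
rewrite YE in III; rewrite /= in IV.
have F3 f : 3%:R * f = 0 :> fps R by apply/fpsP => n; rewrite coefs_natl R3 mul0r.
have leI : (I.+1 <= (2 * I).+1)%N by lia.
have {}V := ordge_le V leI; have {}III := ordge_le III leI; have {}VI := ordge_le VI leI.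
apply: (@ordge_mulI _ _ _ u); first exact: useq_unit.
have thV := ordge_theta V; rewrite !thetaB theta1 (thetaM u A) (thetaM 4%:R Ye) in thV.
have th4 : theta (4%:R : fps R) = 0.
  by rewrite -[4%:R]/(1 + (1 + (1 + 1))) !thetaD theta1 !addr0.
rewrite th4 in thV.
set e1 := u * A - _ in V; set e1' := (theta u * A + _ - _) in thV.
set e4 := u * theta Ye - _ + _ in IV; set e6 := theta u + _ in VI; set e3 := Ye - Yo + _ in III.
(* Applying theta to u A = 1 - 4 Y_even brings in theta A; the other error terms eliminate theta u,
   theta Y_even and [L], and what remains is a multiple of 3. *)
have -> : (u * theta A - Yo) * u = u * e1' - theta u * e1 - 4%:R * e4 - e6 + u * e3 + 3%:R * (u * Ye).
  rewrite /e1' /e1 /e4 /e6 /e3; ring.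
rewrite F3 addr0.
apply: ordgeD; last exact: ordgeMl.
by do 3?[apply: ordgeB => //]; apply: ordgeMl.
Qed.

End ThetaAlpha.

(** * Generating functions of overpartitions *)

Section Overpartitions.

Lemma mem_ov_cands n k s : all (fun x => x.1 <= n) s -> size s <= k -> s \in ov_cands n k.
Proof.
elim: k s => [|k IHk] [|[i b] s] // /andP[le_in s_n] szs.
rewrite inE; apply/orP; right; apply/allpairsP; exists ((i, b), s); split; [|exact: IHk|by []].
by apply/allpairsP; exists (i, b); split; [rewrite mem_iota | case: (b) | ].
Qed.

Lemma mem_overpartitions n s : (s \in overpartitions n) = is_overpartition n s.
Proof.
rewrite mem_undup mem_filter andb_idr // => /and3P[s_gt0 /eqP sum_s _].
have bounds : all (fun x => x.1 <= sumn (parts s)) s && (size s <= sumn (parts s)).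
  elim: s s_gt0 {sum_s} => //= x s IHs /andP[x0 /IHs/andP[s1 s2]].
  rewrite leq_addr /=; apply/andP; split; last by lia.
  by apply: sub_all s1 => y /leq_trans -> //; apply: leq_addl.
by case/andP: bounds => ? ?; apply: mem_ov_cands; rewrite -sum_s.
Qed.

Definition head_le m (s : seq (nat * bool)) := if s is x :: _ then x.1 <= m else true.
(** The tails allowed after a part [m]: a leading [m] in the tail cannot be overlined. *)
Definition follows m (s : seq (nat * bool)) := if s is x :: _ then ovrel (m, true) x else true.

Lemma overpartition_cons n m b s :
  is_overpartition n ((m, b) :: s) = [&& 0 < m <= n, is_overpartition (n - m) s & follows m s].
Proof.
rewrite /is_overpartition /=.
have -> : path ovrel (m, b) s = follows m s && sorted ovrel s by case: s.
case: (all _ s); case: (follows m s); case: (sorted _ s); rewrite ?andbF ?andbT //=.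
by apply/idP/idP => /andP[? ?]; apply/andP; split; lia.
Qed.

Variable R : comNzRingType.
Local Open Scope ring_scope.
Local Notation q := (fpsX R).
Implicit Types (P : pred (seq (nat * bool))) (wt : seq (nat * bool) -> R).

Definition gf P wt : fps R := fun n => \sum_(s <- overpartitions n | P s) wt s.

Lemma coefs_gf P wt n : coefs (gf P wt) n = \sum_(s <- overpartitions n | P s) wt s.
Proof. by []. Qed.

Lemma eq_gf P P' wt wt' :
  (forall n s, is_overpartition n s -> P s = P' s) ->
  (forall n s, is_overpartition n s -> P s -> wt s = wt' s) -> gf P wt = gf P' wt'.
Proof.
move=> PP' ww'; apply/fpsP => n; rewrite !coefs_gf big_seq_cond [RHS]big_seq_cond.
apply: eq_big => [s|s]; rewrite mem_overpartitions; first by apply: andb_id2l => /PP'.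
by case/andP=> /ww'; apply.
Qed.

Lemma gf_head m b wt : (0 < m)%N ->
  gf (fun s => ohead s == Some (m, b)) wt = q ^+ m * gf (follows m) (wt \o cons (m, b)).
Proof.
move=> m_gt0; apply/fpsP => n; rewrite coefsXnM !coefs_gf.
case: leqP => [le_mn | lt_nm]; last first.
  rewrite big_seq_cond big1 // => -[|[i c] s]; rewrite ?andbF //= mem_overpartitions.
  by case/andP=> /[swap] /eqP[-> ->]; rewrite overpartition_cons (leqNgt m n) lt_nm andbF.
rewrite -big_filter (perm_big [seq (m, b) :: s | s <- overpartitions (n - m) & follows m s]) /=.
  by rewrite big_map big_filter.
apply: uniq_perm; rewrite ?map_inj_uniq ?filter_uniq ?undup_uniq //; first by move=> ? ? [].
case=> [|[i c] s]; rewrite mem_filter /=.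
  by apply/esym/mapP => -[].
apply/andP/mapP => [[/eqP[-> ->]] | [s' /[swap] [[-> -> ->]]]].
  by rewrite mem_overpartitions overpartition_cons => /and3P[_ s_op s_f]; exists s; rewrite ?mem_filter ?s_f ?mem_overpartitions.
by rewrite mem_filter !mem_overpartitions overpartition_cons m_gt0 le_mn => /andP[-> ->].
Qed.

Lemma gf_split P P' P'' wt :
  (forall s, P s = P' s || P'' s) -> (forall s, ~~ (P' s && P'' s)) ->
  gf P wt = gf P' wt + gf P'' wt.
Proof.
move=> PE disj; apply/fpsP => n; rewrite coefsD !coefs_gf big_mkcond /=.
rewrite [X in _ = X + _]big_mkcond [X in _ = _ + X]big_mkcond -big_split /=.
apply: eq_bigr => s _; rewrite PE; have := disj s.
by case: (P' s); case: (P'' s); rewrite ?addr0 ?add0r.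
Qed.

(** With [gf_head_le], this builds the run of parts m + 1 from back to front: plain copies first,
    then possibly one overlined copy at the head. *)
Lemma gf_follows m wt :
  gf (follows m.+1) wt =
  gf (head_le m) wt + q ^+ m.+1 * gf (follows m.+1) (wt \o cons (m.+1, false)).
Proof.
rewrite -gf_head //; apply: gf_split => [] [|[i b] s] //=; rewrite /ovrel /= -[Some _ == _]/((i, b) == _) xpair_eqE;
  case: b; lia.
Qed.

Lemma gf_head_le m wt :
  gf (head_le m.+1) wt =
  gf (follows m.+1) wt + q ^+ m.+1 * gf (follows m.+1) (wt \o cons (m.+1, true)).
Proof.
rewrite -gf_head //; apply: gf_split => [] [|[i b] s] //=; rewrite /ovrel /= -[Some _ == _]/((i, b) == _) xpair_eqE;
  case: b; lia.
Qed.

Lemma gf_head_le0 wt : gf (head_le 0) wt = (fun n => if n == 0%N then wt [::] else 0).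
Proof.
apply/fpsP => n; rewrite coefs_gf /coefs -big_filter.
have -> : [seq s <- overpartitions n | head_le 0 s] = if n == 0%N then [:: [::]] else [::].
  apply: perm_small_eq; first by case: eqP.
  apply: uniq_perm; rewrite ?filter_uniq ?undup_uniq //; first by case: eqP.
  case=> [|[i b] s]; rewrite mem_filter mem_overpartitions.
    by rewrite /is_overpartition /= andbT eq_sym; case: eqP.
  rewrite overpartition_cons /=; case: i => [|i]; rewrite ?andbF //=; by case: eqP.
by case: eqP; rewrite ?big_seq1 ?big_nil.
Qed.

End Overpartitions.

(** * Generating functions of the rank and of the smallest part *)

Section Statistics.
Implicit Types (s : seq (nat * bool)) (p : seq nat).

Lemma follows_all n m s : is_overpartition n s -> follows m s -> all (fun x => x.1 <= m) s.
Proof.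
case/and3P=> _ _ s_sorted s_m.
have : path ovrel (m, true) s by case: s s_sorted s_m => //= x s -> ->.
move/(sub_path (e' := fun x y => y.1 <= x.1)) => H.
apply: (order_path_min (leT := fun x y : nat * bool => y.1 <= x.1) (x := (m, true))) (H _).
  by move=> x y z /= xy yz; apply: leq_trans yz xy.
by move=> x y /orP[/ltnW | /andP[/eqP-> _]].
Qed.

Lemma foldr_minn_le x p y : y \in p -> foldr minn x p <= y.
Proof. by elim: p => //= z p IHp; rewrite inE => /predU1P[->|/IHp]; rewrite geq_min ?leqnn // => ->; rewrite orbT. Qed.

Lemma foldr_minn_min x y p : foldr minn (minn x y) p = minn x (foldr minn y p).
Proof. by elim: p => //= z p ->; rewrite minnCA. Qed.

Lemma foldr_minn_mem x p : foldr minn x p \in x :: p.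
Proof.
elim: p => [|z p IHp] /=; first exact: mem_head.
rewrite /minn; case: ifP => _; first by rewrite !inE eqxx orbT.
by move: IHp; rewrite !inE => /orP[->|->]; rewrite ?orbT.
Qed.

Lemma smallest_part_cons m b x s : all (fun y => y.1 <= m) (x :: s) ->
  smallest_part ((m, b) :: x :: s) = smallest_part (x :: s).
Proof.
case: x => a c /andP[/= le_am _]; pose p := a :: parts s.
rewrite -[LHS]/(minn m (foldr minn m p)) -[RHS]/(foldr minn a p).
have fa : foldr minn m p <= a by apply: foldr_minn_le; rewrite mem_head.
have -> : foldr minn a p = foldr minn m p.
  by rewrite -{1}(minn_idPl le_am) foldr_minn_min; apply/minn_idPr.
by apply/minn_idPr/(leq_trans fa).
Qed.

Lemma smallest_part_eq m x s : all (fun y => y.1 <= m) (x :: s) ->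
  (m == smallest_part (x :: s)) = all (fun y => y.1 == m) (x :: s).
Proof.
set t := x :: s => t_m; apply/eqP/allP => [mE y yt|tE].
  rewrite eqn_leq (allP t_m) // mE /smallest_part foldr_minn_le //; exact: map_f.
have := foldr_minn_mem (head 0 (parts t)) (parts t).
rewrite -/(smallest_part t) inE => H.
have {H} /mapP[y yt ->] : smallest_part t \in parts t.
  by case/predU1P: H => [->|//]; rewrite /parts /= mem_head.
by apply/esym/eqP/tE.
Qed.

Lemma largest_part_cons n m b s : is_overpartition n ((m, b) :: s) -> largest_part ((m, b) :: s) = m.
Proof.
rewrite overpartition_cons => /and3P[_ s_op s_m]; rewrite /largest_part /=; apply/maxn_idPl.
elim: s {s_op s_m} (follows_all s_op s_m) => //= x s IHs /andP[xm /IHs sm].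
by rewrite geq_max xm.
Qed.

Variable R : comNzRingType.
Local Open Scope ring_scope.
Local Notation q := (fpsX R).

Definition sign_size s : R := (-1) ^+ size s.
Definition sign_rank s : R := (-1) ^+ (largest_part s + size s).
(** Detects when prepending [m] adds an occurrence of the smallest part; it is 1 on the empty
    sequence. *)
Definition all_equal m s : R := (all (fun x => x.1 == m) s)%:R.
Definition odd_smallest s : R := if odd (smallest_part s) then (num_smallest s)%:R else 0.

Lemma gfD P (f g : seq (nat * bool) -> R) : gf P (fun s => f s + g s) = gf P f + gf P g.
Proof. by apply/fpsP => n; rewrite coefsD !coefs_gf big_split. Qed.
Lemma gf_signl P k (f : seq (nat * bool) -> R) : gf P (fun s => (-1) ^+ k * f s) = (-1) ^+ k * gf P f.
Proof. by apply/fpsP => n; rewrite coefs_signl !coefs_gf mulr_sumr. Qed.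
Lemma gf_natl P k (f : seq (nat * bool) -> R) : gf P (fun s => k%:R * f s) = k%:R * gf P f.
Proof. by apply/fpsP => n; rewrite coefs_natl !coefs_gf mulr_sumr. Qed.

Lemma gf_head_le0_1 (wt : seq (nat * bool) -> R) : wt [::] = 1 -> gf (head_le 0) wt = 1.
Proof. by move=> wt0; rewrite gf_head_le0 wt0; apply/fpsP => n; rewrite coefs1 /coefs; case: eqP. Qed.

(** Prepending a part flips the sign, so the parts equal to m + 1 contribute the factor (1 -
    q^(m+1)) / (1 + q^(m+1)). *)
Lemma gf_sign_size m : gf (head_le m) sign_size = useq R m.
Proof.
elim: m => [|m IHm]; first by rewrite useq0 gf_head_le0_1.
have consE x : gf (follows m.+1) (sign_size \o cons x) = - gf (follows m.+1) sign_size.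
  rewrite -mulN1r -[-1]expr1 -gf_signl; apply: eq_gf => // n s _ _.
  by rewrite /sign_size /= exprS.
have u1 : 1 + q ^+ m.+1 \is a GRing.unit by apply: unit_qD.
apply: (mulIr u1); rewrite useqS -IHm.
have := gf_head_le m sign_size; have := gf_follows m sign_size; rewrite !consE => E ->.
have -> : gf (head_le m) sign_size = gf (follows m.+1) sign_size * (1 + q ^+ m.+1).
  by rewrite -(addrK (q ^+ m.+1 * - gf (follows m.+1) sign_size) (gf (head_le m) _)) -E; ring.
by ring.
Qed.

Lemma gf_all_equal m : gf (follows m.+1) (all_equal m.+1) * (1 - q ^+ m.+1) = 1.
Proof.
have := gf_follows m (all_equal m.+1).
have -> : gf (follows m.+1) (all_equal m.+1 \o cons (m.+1, false)) = gf (follows m.+1) (all_equal m.+1).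
  by apply: eq_gf => // n s _ _; rewrite /all_equal /= eqxx.
have -> : gf (head_le m) (all_equal m.+1) = 1.
  rewrite -(gf_head_le0_1 (wt := all_equal m.+1)) //.
  apply/fpsP => n; rewrite !coefs_gf big_mkcond [RHS]big_mkcond; apply: eq_bigr => [] [|[i b] s] _ //=.
  have a0 : (i <= m)%N -> all_equal m.+1 ((i, b) :: s) = 0.
    by move=> le_im; rewrite /all_equal /= ltn_eqF.
  by case: (leqP i m) => [/a0->|_]; case: (leqP i 0) => // i0; rewrite ?if_same // a0 //; lia.
move=> E; rewrite mulrBr mulr1 {1}E; ring.
Qed.

(** A new largest part leaves the smallest part and its count unchanged unless all parts equal it.
    The empty sequence has smallest part 0, which is even, hence weight 0. *)
Lemma odd_smallest_cons n m b s : is_overpartition n s -> follows m s ->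
  odd_smallest ((m, b) :: s) = odd_smallest s + (odd m)%:R * all_equal m s.
Proof.
move=> s_op s_m; have := follows_all s_op s_m; case: s {s_op s_m} => [_|x s s_m].
  by rewrite /odd_smallest /all_equal /num_smallest /smallest_part /= minnn eqxx mulr1 add0r; case: odd.
rewrite /odd_smallest /num_smallest /all_equal -(smallest_part_eq s_m).
rewrite (smallest_part_cons b s_m).
set k := smallest_part _; rewrite -[parts ((m, b) :: _)]/(m :: parts (x :: s)).
move: (parts (x :: s)) => p; rewrite [count _ (m :: p)]/= natrD.
case: eqP => [->|_]; last by rewrite mulr0 addr0 add0r.
by rewrite mulr1; case: odd; rewrite ?addr0 // addrC.
Qed.

(** Larger parts rescale the function by u_m / u_(m+1). For odd m + 1, the overpartitions with all
    parts m + 1 add a source that becomes d_(m+1) / (1 - q^(m+1)) after multiplication by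
    u_(m+1). *)
Lemma gf_odd_smallest m : gf (head_le m) odd_smallest * useq R m = Ysum R odd m.
Proof.
elim: m => [|m IHm].
  rewrite useq0 mulr1 gf_head_le0 /Ysum big_ord0.
  by apply/fpsP => n; rewrite coefs0 /coefs; case: eqP.
set Z := q ^+ m.+1; pose a := gf (follows m.+1) (all_equal m.+1); pose o : fps R := (odd m.+1)%:R.
have consE b : gf (follows m.+1) (odd_smallest \o cons (m.+1, b)) = gf (follows m.+1) odd_smallest + o * a.
  rewrite -gf_natl -gfD; apply: eq_gf => // n s s_op s_m; exact: (odd_smallest_cons b s_op s_m).
have u1 : 1 - Z \is a GRing.unit by apply: unit_qB.
have u2 : 1 + Z \is a GRing.unit by apply: unit_qD.
have aE : a = (1 - Z)^-1 by apply: (mulIr u1); rewrite mulVr //; exact: gf_all_equal.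
have YE : Ysum R odd m.+1 = Ysum R odd m + o * (dseq R m * a).
  rewrite {1}/Ysum big_mkcond big_ord_recr -big_mkcond aE /o; congr (_ + _).
  by rewrite -/Z; case: (odd m.+1); rewrite ?mul0r ?mul1r.
have uS : useq R m.+1 * (1 + Z) = useq R m * (1 - Z) := useqS R m.
have dE : dseq R m = (useq R m + useq R m.+1) * Z.
  by apply: (mulIr u2); rewrite dseqD -/Z; transitivity ((useq R m * (1 + Z) + useq R m.+1 * (1 + Z)) * Z); [rewrite uS|]; ring.
rewrite YE -IHm dE.
have := gf_head_le m odd_smallest; have := gf_follows m odd_smallest; rewrite !consE -/Z => E ->.
have {E} -> : gf (head_le m) odd_smallest = gf (follows m.+1) odd_smallest * (1 - Z) - Z * (o * a).
  by rewrite mulrBr mulr1 {1}E; ring.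
move: uS (gf _ _) => {dE} uS V.
transitivity (V * (useq R m.+1 * (1 + Z)) + Z * o * a * useq R m.+1); first by ring.
by rewrite uS; ring.
Qed.

(** Largest part m + 1 contributes (-1)^(m+1) times the increment u_(m+1) - u_m of
    [gf_sign_size]. *)
Lemma gf_sign_rank m : gf (head_le m) sign_rank = Hsum m (-1).
Proof.
elim: m => [|m IHm]; first by rewrite gf_head_le0_1 // /Hsum big_ord0 subr0.
pose hd (s : seq (nat * bool)) := if s is x :: _ then (x.1 == m.+1)%N else false.
have split wt : gf (head_le m.+1) wt = gf (head_le m) wt + gf hd wt :> fps R.
  by apply: gf_split => [] [|x s] //=; lia.
have hdE : gf hd sign_rank = (-1) ^+ m.+1 * gf hd sign_size.
  rewrite -gf_signl; apply: eq_gf => // n [|[i b] s] // s_op /eqP /= iE.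
  by rewrite /sign_rank exprD (largest_part_cons s_op) iE.
have := split sign_size; rewrite !gf_sign_size split IHm hdE => E.
have -> : gf hd sign_size = - dseq R m by rewrite /dseq E; ring.
by rewrite /Hsum big_ord_recr /=; ring.
Qed.

Lemma gf_total m n (wt : seq (nat * bool) -> R) : (n <= m)%N ->
  coefs (gf (head_le m) wt) n = \sum_(s <- overpartitions n) wt s.
Proof.
move=> le_nm; rewrite coefs_gf big_mkcond; apply: eq_big_seq => [] [|[i b] s] //=.
rewrite mem_overpartitions overpartition_cons => /andP[/andP[_ le_in] _].
by rewrite (leq_trans le_in le_nm).
Qed.

Lemma spt1bar_sum n : \sum_(s <- overpartitions n) odd_smallest s = (spt1bar n)%:R.
Proof. by rewrite /spt1bar natr_sum [RHS]big_mkcond. Qed.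

Lemma alphabar_sum n : \sum_(s <- overpartitions n) sign_rank s = (alphabar n)%:~R.
Proof.
rewrite /alphabar; elim: (overpartitions n) => [|s l IHl]; first by rewrite big_nil.
rewrite big_cons IHl /=.
have -> : sign_rank s = (-1) ^+ odd `|ov_rank s|.
  rewrite /sign_rank -signr_odd; congr (_ ^+ nat_of_bool _); rewrite /ov_rank; lia.
by case: odd; rewrite /= ?expr0 ?expr1 !PoszD !(intrB, intrD); ring.
Qed.

End Statistics.

(** * From coefficients over ['F_3] to the integer congruence *)

Lemma intr_F3_eq0 (z : int) : (z%:~R = 0 :> 'F_3)%R -> (3 %| z)%Z.
Proof.
move=> z0; have r0 : ((z %% 3)%Z%:~R = 0 :> 'F_3)%R.
  have z3 : ((3 : int)%:~R = 0 :> 'F_3)%R by apply/val_inj.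
  by have := congr1 (fun y : int => y%:~R : 'F_3)%R (divz_eq z 3); rewrite z0 intrD intrM z3 mulr0 add0r.
apply/dvdz_mod0P; have := modz_ge0 z (isT : 3 != 0 :> int)%R; have := ltz_pmod z (isT : 0 < 3 :> int)%R.
case: (z %% 3)%Z r0 => // -[|[|[|k]]] //.
Qed.

Theorem theorem1p4 (n : nat) (hn : 1 <= n) :
  ((spt1bar n)%:Z = legendre3 n * alphabar n %[mod 3])%Z.
Proof.
have F3 : (3%:R = 0 :> 'F_3)%R by apply/val_inj.
(* The truncation index is even, as the theta expansion of u requires, and at least [n], so that
   every overpartition of [n] is counted. *)
pose u := useq 'F_3 (2 * n); pose G := gf (head_le (2 * n)) (@odd_smallest 'F_3).
have le_n : n <= 2 * n by lia.
(* Y_odd is [G * u], so the unit u divides out and coefficient [n] of theta A - [G] is zero. *)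
have := theta_Hsum F3 n; rewrite -gf_odd_smallest -gf_sign_rank -/u -/G mulrC -mulrBl.
move/(ordge_mulI (useq_unit _ _))/coefs_ordge => /(_ n (leqnn _)).
rewrite coefsB coefs_theta !gf_total // spt1bar_sum alphabar_sum => E.
have : (3 %| (n%:Z * alphabar n - (spt1bar n)%:Z)%R)%Z.
  by apply: intr_F3_eq0; rewrite intrB intrM -!pmulrn.
rewrite /legendre3; move: (alphabar n) (spt1bar n) => a s.
have := divn_eq n 3; have := ltn_pmod n (isT : 0 < 3).
move: (n %/ 3) (n %% 3) => k [|[|[|r]]] // _ -> D /=; apply/eqP; rewrite eqz_mod_dvd; lia.
Qed.
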